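(* There is no asymptotically consistent discrimination procedure for the set of all $B$-processes (with binary alphabet). That is, there is no family of mappings $D_n:\{0,1\}^n\times\{0,1\}^n\to\{0,1\}$, $n\in\mathbb N$, such that for every two $B$-processes $\rho_{\mathbf x},\rho_{\mathbf y}$, when the sequences $X_1,X_2,\dots$ and $Y_1,Y_2,\dots$ are generated independently of each other by $\rho_{\mathbf x}$ and $\rho_{\mathbf y}$ respectively, the limit $\lim_{n\to\infty}\mathbb E\,D_n((X_1,\dots,X_n),(Y_1,\dots,Y_n))$ exists and is equal to $0$ if $\rho_{\mathbf x}=\rho_{\mathbf y}$ and to $1$ otherwise.
   Context: The alphabet is $A=\{0,1\}$; a process is a probability measure on $A^\infty$ with its Borel sigma-algebra. It is stationary if it is invariant under the time shift. For two stationary processes $\rho_{\mathbf x},\rho_{\mathbf y}$ the $\bar d$-distance $\bar d(\rho_{\mathbf x},\rho_{\mathbf y})$ is the infimum of those $\epsilon$ for which there is a stationary process $\nu_{xy}$ on pairs $(X_n,Y_n)$, $n\in\mathbb N$, such that $(X_n)_{n\in\mathbb N}$ is distributed according to $\rho_{\mathbf x}$, $(Y_n)_{n\in\mathbb N}$ is distributed according to $\rho_{\mathbf y}$, and $\nu_{xy}(X_1\ne Y_1)\le\epsilon$. A (stationary) process is called a $B$-process if it is in the $\bar d$-closure of the set of all aperiodic stationary ergodic $k$-step Markov processes, where $k\in\mathbb N$ is arbitrary. *)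

(* Defs.v *)
From HB Require Import structures.
From mathcomp Require Import all_boot all_order all_algebra.
From mathcomp Require Import all_classical all_reals all_analysis.

Set Implicit Arguments.
Unset Strict Implicit.
Unset Printing Implicit Defensive.

Import Order.TTheory GRing.Theory Num.Theory.
Import numFieldNormedType.Exports.

Local Open Scope classical_set_scope.
Local Open Scope ring_scope.

(* The library gives a product its point and its topology but not their join. *)
HB.instance Definition _ (A B : ptopologicalType) := Pointed.on (A * B)%type.

(* Infinite sequences over [A] with the Borel sigma-algebra of the product
   topology.  Coordinates start at 0, so that X_1 is [x 0]. *)
Definition seqs (A : ptopologicalType) : Type :=
  prod_topology (fun _ : nat => A).

HB.instance Definition _ (A : ptopologicalType) := Pointed.on (seqs A).
HB.instance Definition _ (A : ptopologicalType) := Topological.on (seqs A).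

Definition borel (A : ptopologicalType) : set (set (seqs A)) :=
  <<s @open (seqs A) >>.

Definition borel_display (A : ptopologicalType) : measure_display :=
  sigma_display (@open (seqs A)).

HB.instance Definition _ (A : ptopologicalType) :=
  @isMeasurable.Build (borel_display A) (seqs A) (@borel A)
    (@sigma_algebra0 _ setT (@open (seqs A)))
    (@sigma_algebraC _ (@open (seqs A)))
    (@sigma_algebra_bigcup _ setT (@open (seqs A))).

Definition process (R : realType) (A : ptopologicalType) :=
  probability (seqs A) R.

(* Measures in the library are functions on all sets whose values on
   non-measurable sets are unconstrained, so equality of processes is agreement
   on the measurable sets, not Leibniz equality. *)
Definition same_process (R : realType) (A : ptopologicalType)
    (P Q : process R A) : Prop :=
  forall B : set (seqs A), measurable B -> P B = Q B.

Definition time_shift (A : ptopologicalType) (x : seqs A) : seqs A :=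
  fun n => x n.+1.

Definition stationary (R : realType) (A : ptopologicalType)
    (P : process R A) : Prop :=
  forall B : set (seqs A), measurable B -> P (@time_shift A @^-1` B) = P B.

Definition ergodic (R : realType) (A : ptopologicalType)
    (P : process R A) : Prop :=
  forall B : set (seqs A), measurable B -> @time_shift A @^-1` B = B ->
    P B = 0%E \/ P B = 1%E.

Definition block (A : ptopologicalType) (i n : nat) (x : seqs A) : n.-tuple A :=
  [tuple x (i + j)%N | j < n].

Definition cond_prob (R : realType) (A : ptopologicalType) (P : process R A)
    (E F : set (seqs A)) : R :=
  fine (P (E `&` F)) / fine (P F).

Definition markov_of_order (R : realType) (A : ptopologicalType) (k : nat)
    (P : process R A) : Prop :=
  forall (m : nat) (u : m.-tuple A) (v : k.-tuple A) (a : A),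
    (0 < P [set x | block 0 (m + k) x = [tuple of u ++ v]])%E ->
    cond_prob P [set x | x (m + k)%N = a]
                [set x | block 0 (m + k) x = [tuple of u ++ v]] =
    cond_prob P [set x | x (m + k)%N = a] [set x | block m k x = v].

(* Every state [w] of positive probability of the chain of [k]-blocks has
   period 1: the only common divisor of its possible return times is 1. *)
Definition aperiodic (R : realType) (A : ptopologicalType) (k : nat)
    (P : process R A) : Prop :=
  forall w : k.-tuple A, (0 < P [set x | block 0 k x = w])%E ->
    forall d : nat,
      (forall n : nat, (0 < n)%N ->
         0 < cond_prob P [set x | block n k x = w] [set x | block 0 k x = w] ->
         (d %| n)%N) ->
      d = 1%N.

Definition left_seq (A B : ptopologicalType) (z : seqs (A * B)%type) : seqs A :=
  fun n => (z n).1.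

Definition right_seq (A B : ptopologicalType) (z : seqs (A * B)%type) : seqs B :=
  fun n => (z n).2.

Definition stationary_joining (R : realType) (A : ptopologicalType)
    (P Q : process R A) (nu : process R (A * A)%type) : Prop :=
  [/\ stationary nu,
      forall B : set (seqs A), measurable B ->
        nu (@left_seq A A @^-1` B) = P B &
      forall B : set (seqs A), measurable B ->
        nu (@right_seq A A @^-1` B) = Q B].

(* The infimum is taken in the extended reals, so that it would be +oo rather
   than a junk value if there were no joining. *)
Definition dbar (R : realType) (A : ptopologicalType)
    (P Q : process R A) : \bar R :=
  ereal_inf [set e%:E | e in [set e : R |
    exists nu : process R (A * A)%type, stationary_joining P Q nu /\
      (nu [set z | (z 0%N).1 <> (z 0%N).2] <= e%:E)%E]].

Definition aperiodic_ergodic_markov (R : realType) (P : process R bool) : Prop :=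
  exists k : nat, [/\ (0 < k)%N, stationary P, ergodic P, markov_of_order k P &
    aperiodic k P].

Definition B_process (R : realType) (P : process R bool) : Prop :=
  stationary P /\
  forall e : R, 0 < e ->
    exists Q : process R bool, aperiodic_ergodic_markov Q /\
      (dbar P Q < e%:E)%E.

Definition discrimination_procedure :=
  forall n : nat, n.-tuple bool -> n.-tuple bool -> bool.

(* The two samples are independent, i.e. their joint law is the product
   measure; the value [true] of a procedure stands for 1. *)
Definition expected_answer (R : realType) (D : discrimination_procedure)
    (P Q : process R bool) (n : nat) : \bar R :=
  'E_(P \x Q)%E[fun w => (D n (block 0 n w.1) (block 0 n w.2))%:R].

Definition asymptotically_consistent (R : realType)
    (D : discrimination_procedure) : Prop :=
  forall P Q : process R bool, B_process P -> B_process Q ->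
    (same_process P Q -> expected_answer D P Q @ \oo --> 0%E) /\
    (~ same_process P Q -> expected_answer D P Q @ \oo --> 1%E).

(* Main.v *)
Require Import Defs.
From mathcomp Require Import all_boot all_order all_algebra.
From mathcomp Require Import all_classical all_reals all_analysis.
From mathcomp Require Import measurable_realfun.
From mathcomp Require Import ring lra zify.

Set Implicit Arguments.
Unset Strict Implicit.
Unset Printing Implicit Defensive.

Import Order.TTheory GRing.Theory Num.Theory.
Import numFieldNormedType.Exports.

Local Open Scope classical_set_scope.
Local Open Scope ring_scope.

(** Consistency fails on a single process that looks, at infinitely many times,
    like two different ones. Let [X] be a B-process which for infinitely many
    [n] has the following property: up to a small error, its first [n] symbols
    are distributed as an equal mixture of the laws of two B-processes [U] and
    [V] with different laws, and [n] is so large that the procedure says 1 with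
    probability at least 1/2 on a sample of [U] and an independent sample of
    [V]. Two independent samples of [X] look like such a pair with probability
    about 1/4, so the expected answer on ([X], [X]) is infinitely often bounded
    away from 0, although consistency requires it to tend to 0.

    All processes are built from one fair-coin sequence [x], cut into infinitely
    many independent rows; dropping the first row is the passage of time. A row
    has height at least [k] ([high b k]) with probability 2^-(b k). The state of
    level [j] ([state]) is a random digit stored in the next row of height at
    least [j + 1], so it changes at such rows only. The output at time 0 is the
    state of level [j], where [j] is the height of row 0; this is [limit].
    Replacing the states of all levels [>= k] by a constant [s] gives
    [layer b k s]. The two constants give different laws, because rows of height
    at least [k] occur. As long as no row of height [k + 1] occurs, the limit
    coincides with [layer b k s], where [s] is the current state of level [k],
    which is a fair bit independent of the layer ([pr_settled_window]): this is
    the mixture above ([mean_answer_limit_ge]). The heights are chosen one by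
    one: the two layers of level [k] only depend on [b 0], ..., [b k], the
    procedure separates them at some time [n], and then [b (k + 1)] is taken so
    large that rows of height [k + 1] are not seen before time [n].

    It remains to see that layers and their limit are B-processes
    ([B_process_of_layers]). The output of a layer is settled by the rows up to
    the next one of height at least [k], so rows far away hardly matter. Cut time
    into blocks of a large length [L], separated by geometric idle periods and
    placed independently of the layer; let outputs that are not settled within
    their block be 0; and overwrite a small proportion of the symbols, so that
    the beginnings of blocks can be recognised ([block_code]). The contents of
    the blocks are then independent, and the position in the current block is
    known from the last [L + m + 1] symbols ([same_word_same_phase]), so the
    coded process is exactly Markov of that order. It is ergodic and aperiodic
    because enough consecutive coins drive any phase to a prescribed one
    ([phase_synchronised]). The layer, the limit and the code are functions of
    the same coins and the same phase, hence they are joined, and their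
    d-bar distance is at most the probability that they differ at time 0
    ([law_dbar_le]). *)

(** * Sequence spaces over a finite discrete alphabet *)

Definition depends_below (A : ptopologicalType) (n : nat) (V : set (seqs A)) :=
  forall x y : seqs A, (forall i, (i < n)%N -> x i = y i) -> V x -> V y.

(** Otherwise, points outside [U] that agree with [x] on longer and longer
    prefixes would converge to [x]. *)
Lemma open_cylinder (A : ptopologicalType) (U : set (seqs A)) (x : seqs A) :
  open U -> U x ->
  exists n, forall y : seqs A, (forall i, (i < n)%N -> y i = x i) -> U y.
Proof.
move=> oU Ux; apply: contrapT => /forallNP H.
have /choice[y yP] : forall n, exists y : seqs A,
    (forall i, (i < n)%N -> y i = x i) /\ ~ U y.
  by move=> n; have /existsNP[y /not_implyP[? ?]] := H n; exists y.
have cy : y @ \oo --> (x : seqs A).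
  apply/cvg_sup => i B /= [_ [[C oC <-] /= Cxi sCB]].
  exists i.+1 => // n /= ltin; apply: sCB => /=.
  by have [-> //] := yP n.
have /cy[N _ NU] : nbhs x U by apply: open_nbhs_nbhs.
by have [_] := yP N; apply; apply: NU => /=.
Qed.

Definition set_coord (A : ptopologicalType) (n : nat) (a : A) (x : seqs A) :
  seqs A := fun i => if i == n then a else x i.

Section finite_alphabet.
Context (A : ptopologicalType) (finA : finite_set [set: A])
  (openA : forall B : set A, open B).

Lemma measurable_coord (n : nat) (B : set A) :
  measurable [set x : seqs A | B (x n)].
Proof.
apply: sub_sigma_algebra.
have cn : continuous (fun x : seqs A => x n).
  exact: (@proj_continuous nat (fun=> A) n).
by move/continuousP: cn => /(_ B); apply; exact: openA.
Qed.

(** The last letter read takes finitely many values, and fixing it leaves an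
    event that reads one letter less. *)
Lemma measurable_preimage_depends_below d (Y : measurableType d)
    (g : Y -> seqs A) (n : nat) (V : set (seqs A)) :
  (forall i a, measurable [set y | g y i = a]) ->
  depends_below n V -> measurable (g @^-1` V).
Proof.
move=> mg; elim: n V => [|n IH] V dV.
  have [[x Vx]|V0] := pselect (exists x, V x).
    suff -> : g @^-1` V = setT by exact: measurableT.
    by apply/seteqP; split => // y _; apply: dV Vx.
  suff -> : g @^-1` V = set0 by exact: measurable0.
  by apply/seteqP; split => // y Vy; apply: V0; exists (g y).
have -> : g @^-1` V =
    \bigcup_a ([set y | g y n = a] `&` g @^-1` (set_coord n a @^-1` V)).
  apply/seteqP; split => y /=.
    move=> Vy; exists (g y n) => //; split => //=.
    by apply: dV Vy => i _; rewrite /set_coord; case: eqP => [->|].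
  move=> [a _ [<- /=]]; apply: dV => i _.
  by rewrite /set_coord; case: eqP => [->|].
apply: fin_bigcup_measurable => // a _; apply: measurableI; first exact: mg.
apply: IH => x y xy /=; apply: dV => i; rewrite ltnS leq_eqVlt /set_coord.
by case: eqP => //= _; exact: xy.
Qed.

Lemma measurable_depends_below (n : nat) (V : set (seqs A)) :
  depends_below n V -> measurable V.
Proof.
move=> dV; apply: (@measurable_preimage_depends_below _ _ id) dV => i a.
exact: (measurable_coord i [set a]).
Qed.

Lemma borel_depends_below :
  @borel A = <<s [set V | exists n, depends_below n V] >>.
Proof.
apply/seteqP; split.
  apply: smallest_sub; first exact: smallest_sigma_algebra.
  move=> U oU.
  have -> : U = \bigcup_n [set x | forall y : seqs A,
      (forall i, (i < n)%N -> y i = x i) -> U y].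
    apply/seteqP; split => x.
      by move=> /(open_cylinder oU)[n nU]; exists n.
    by move=> [n _]; apply.
  apply: sigma_algebra_bigcup => n; apply: sub_sigma_algebra; exists n.
  by move=> x y xy Ux z zy; apply: Ux => i ltin; rewrite zy// xy.
apply: smallest_sub; first exact: smallest_sigma_algebra.
by move=> V [n dV]; exact: (@measurable_depends_below n).
Qed.

Lemma measurable_fun_seqs d (Y : measurableType d) (g : Y -> seqs A) :
  (forall i a, measurable [set y | g y i = a]) -> measurable_fun setT g.
Proof.
move=> mg; apply: (@measurability _ _ _ _ _ _ [set V | exists n, depends_below n V]).
  exact: borel_depends_below.
move=> _ [V [n dV] <-]; rewrite setTI.
exact: measurable_preimage_depends_below mg dV.
Qed.

Lemma process_unique (R : realType) (P Q : process R A) :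
  (forall n V, depends_below n V -> P V = Q V) -> same_process P Q.
Proof.
move=> PQ B mB.
apply: (measure_unique [set V | exists n, depends_below n V] (fun=> setT)) => //.
- exact: borel_depends_below.
- move=> V W [m dV] [n dW]; exists (maxn m n) => x y xy [Vx Wx]; split.
    by apply: dV Vx => i ltim; apply: xy; rewrite leq_max ltim.
  by apply: dW Wx => i ltin; apply: xy; rewrite leq_max ltin orbT.
- by move=> _; exists 0%N.
- by rewrite bigcup_const.
- by move=> V [n]; exact: PQ.
- by move=> _; exact: (le_lt_trans (probability_le1 P measurableT) (ltry 1)).
Qed.

End finite_alphabet.

Lemma finite_bool : finite_set [set: bool].
Proof. exact: finite_finset. Qed.

Lemma open_bool (B : set bool) : open B.
Proof. exact: discrete_open. Qed.

Lemma finite_bool2 : finite_set [set: bool * bool].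
Proof. exact: finite_finset. Qed.

Lemma open_bool2 (B : set (bool * bool)) : open B.
Proof.
rewrite openE => -[a b] Bab; exists ([set a], [set b]) => /=.
  by split; apply: open_nbhs_nbhs; split => //; exact: open_bool.
by move=> [a' b'] /= [-> ->].
Qed.

(** * Real-valued probabilities *)

Section real_probability.
Context d (T : measurableType d) (R : realType) (P : probability T R).
Implicit Types E F : set T.

Definition pr E : R := fine (P E).

Lemma prE E : measurable E -> P E = (pr E)%:E.
Proof. by move=> mE; rewrite /pr fineK// fin_num_measure. Qed.

Lemma pr_ge0 E : 0 <= pr E.
Proof. by rewrite /pr fine_ge0// measure_ge0. Qed.

Lemma pr_setT : pr setT = 1.
Proof. by rewrite /pr probability_setT. Qed.

Lemma pr_set0 : pr set0 = 0.
Proof. by rewrite /pr measure0. Qed.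

Lemma le_pr E F : measurable E -> measurable F -> E `<=` F -> pr E <= pr F.
Proof.
move=> mE mF EF; rewrite -lee_fin -!prE//.
by apply: le_measure; rewrite ?inE.
Qed.

Lemma pr_le1 E : measurable E -> pr E <= 1.
Proof. by move=> mE; rewrite -pr_setT; apply: le_pr. Qed.

Lemma prID E F : measurable E -> measurable F ->
  pr E = pr (E `&` F) + pr (E `&` ~` F).
Proof.
move=> mE mF; have mEF : measurable (E `&` F) by exact: measurableI.
have mEC : measurable (E `&` ~` F).
  by apply: measurableI => //; exact: measurableC.
apply: EFin_inj; rewrite EFinD -!prE//.
by rewrite addeC -setDE -measureDI.
Qed.

Lemma prU E F : measurable E -> measurable F -> E `&` F = set0 ->
  pr (E `|` F) = pr E + pr F.
Proof.
move=> mE mF EF0; have mU : measurable (E `|` F) by exact: measurableU.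
by apply: EFin_inj; rewrite EFinD -!prE// measureU.
Qed.

Lemma prC E : measurable E -> pr (~` E) = 1 - pr E.
Proof.
by move=> mE; rewrite -pr_setT (prID measurableT mE) !setTI addrAC subrr add0r.
Qed.

Lemma prU_le E F : measurable E -> measurable F -> pr (E `|` F) <= pr E + pr F.
Proof.
move=> mE mF; have mU : measurable (E `|` F) by exact: measurableU.
by rewrite -lee_fin EFinD -!prE//; exact: measureU2.
Qed.

(** Boole's inequality, for events with a common bound. *)
Lemma pr_exists_lt_le (F : nat -> set T) (n : nat) (p : R) :
  (forall i, measurable (F i)) -> (forall i, pr (F i) <= p) ->
  pr [set x | exists2 i, (i < n)%N & F i x] <= n%:R * p.
Proof.
move=> mF Fp; elim: n => [|n IH].
  by rewrite (_ : mkset _ = set0) ?pr_set0 ?mul0r//; apply/seteqP; split => // x [].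
have mb m : measurable [set x | exists2 i, (i < m)%N & F i x].
  rewrite (_ : mkset _ = \bigcup_(i < m) F i); last by apply/seteqP; split.
  by apply: bigcup_measurable.
rewrite (_ : mkset _ = [set x | exists2 i, (i < n)%N & F i x] `|` F n).
  apply: (le_trans (prU_le (mb n) (mF n))).
  by rewrite -natr1 mulrDl mul1r lerD.
apply/seteqP; split => x /=.
  move=> [i]; rewrite ltnS leq_eqVlt => /orP[/eqP ->|ltin]; first by right.
  by left; exists i.
move=> [[i ltin Fi]|Fn]; last by exists n.
by exists i => //; exact: ltnW.
Qed.

Lemma pr_partition (I : finType) (f : T -> I) E :
  measurable E -> (forall i, measurable [set x | f x = i]) ->
  pr E = \sum_(i : I) pr (E `&` [set x | f x = i]).
Proof.
move=> mE mf; apply: EFin_inj; rewrite -sumEFin.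
rewrite [RHS](eq_bigr (fun i => P (E `&` [set x | f x = i]))); last first.
  by move=> i _; rewrite prE//; exact: measurableI.
rewrite -prE// [in LHS](_ : E = \bigcup_(i in [set: I]) (E `&` [set x | f x = i])).
  rewrite measure_fin_bigcup//.
  - rewrite (fsbigE (index_enum I)) ?index_enum_uniq//.
      by apply: eq_bigl => i; rewrite in_setT.
    by move=> i _; rewrite /= mem_index_enum.
  - exact: finite_finset.
  - by move=> i j _ _ [x [[_ <-] [_ <-]]].
  - by move=> i _; exact: measurableI.
by apply/seteqP; split => [x Ex|x [i _ []]//]; exists (f x).
Qed.

End real_probability.

Lemma measurable_fun_preimage d d' (T : measurableType d) (Y : measurableType d')
    (g : T -> Y) (B : set Y) :
  measurable_fun setT g -> measurable B -> measurable (g @^-1` B).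
Proof. by move=> mg mB; rewrite -[X in measurable X]setTI; exact: mg. Qed.

(** The average of the images of [P] is the law of [h a] for a uniform [a]
    independent of [P]; for [L = 0] it is the image of [P] under [h 0]. *)
Lemma mean_image d d' (T : measurableType d) (Y : measurableType d')
    (R : realType) (P : probability T R) (L : nat) (h : nat -> T -> Y) :
  (forall a, measurable_fun setT (h a)) ->
  exists Q : probability Y R, forall B, measurable B ->
    pr Q B = L.+1%:R^-1 * \sum_(a < L.+1) pr P (h a @^-1` B).
Proof.
move=> mh; pose X a : {mfun T >-> Y} := mfun_Sub (mem_set (mh a)).
pose m a : {measure set Y -> \bar R} := distribution P (X a).
pose Q : probability Y R := mnormalize (msum m L.+1) (m 0%N).
have mT : msum m L.+1 setT = L.+1%:R%:E.
  rewrite /msum (eq_bigr (fun=> 1%E)).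
    by rewrite sumEFin sumr_const card_ord.
  by move=> i _; rewrite /m/= probability_setT.
have mE B : measurable B ->
    msum m L.+1 B = (\sum_(a < L.+1) pr P (h a @^-1` B))%:E.
  move=> mB; rewrite /msum -sumEFin; apply: eq_bigr => i _.
  by rewrite -prE//; exact: measurable_fun_preimage.
exists Q => B mB; rewrite {1}/pr.
have -> : Q B = (msum m L.+1 B * (fine (msum m L.+1 setT))^-1%:E)%E.
  rewrite /Q /=; transitivity (mnormalize (msum m L.+1) (m 0%N) B) => //.
  rewrite /mnormalize; case: ifPn => // /orP[] /eqP /(etrans (esym mT)) // [].
  by move/eqP; rewrite pnatr_eq0.
by rewrite mT mE//= mulrC.
Qed.

(** * The fair-coin process *)

(** Quantifying over all events [V] below [n], not only over words, makes this
    property easy to transport along maps of sequences. *)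
Definition fair (R : realType) (mu : process R bool) :=
  forall n (V : set (seqs bool)) (b : bool), depends_below n V ->
    pr mu (V `&` [set x | x n = b]) = pr mu V / 2.

Lemma measurable_bool_coord n (b : bool) : measurable [set x : seqs bool | x n = b].
Proof. exact: (@measurable_coord _ open_bool n [set b]). Qed.

Lemma measurable_const d (T : measurableType d) (P : Prop) :
  measurable [set _ : T | P].
Proof.
have [p|p] := pselect P.
  by rewrite (_ : mkset _ = setT)//; apply/seteqP; split.
by rewrite (_ : mkset _ = set0)//; apply/seteqP; split.
Qed.

Lemma measurable_bool_below n (V : set (seqs bool)) :
  depends_below n V -> measurable V.
Proof. exact: measurable_depends_below finite_bool open_bool _ _. Qed.

Lemma measurable_bool_seqs d (Y : measurableType d) (g : Y -> seqs bool) :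
  (forall i, measurable [set y | g y i]) -> measurable_fun setT g.
Proof.
move=> mg; apply: (measurable_fun_seqs finite_bool open_bool) => i [].
  exact: mg.
rewrite (_ : mkset _ = ~` [set y | g y i]); first exact: measurableC.
by apply/seteqP; split => y /=; case: (g y i).
Qed.

(** The two values of the last letter read are equally likely given the rest, so
    the probability of [V] is the mean of those of its two sections. *)
Lemma fair_unique (R : realType) (mu nu : process R bool) :
  fair mu -> fair nu -> same_process mu nu.
Proof.
move=> fmu fnu; apply: (process_unique finite_bool open_bool) => n V dV.
have mV := measurable_bool_below dV; rewrite !prE//; congr EFin.
elim: n V dV {mV} => [|n IH] V dV.
  have [[x Vx]|V0] := pselect (exists x, V x).
    suff -> : V = setT by rewrite !pr_setT.
    by apply/seteqP; split => // y _; apply: dV Vx.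
  suff -> : V = set0 by rewrite !pr_set0.
  by apply/seteqP; split => // y Vy; apply: V0; exists y.
pose W b := @set_coord bool n b @^-1` V.
have dW b : depends_below n (W b).
  move=> x y xy; apply: dV => i; rewrite ltnS leq_eqVlt /set_coord.
  by case: eqP => //= _; exact: xy.
have VW b : V `&` [set x | x n = b] = W b `&` [set x | x n = b].
  apply/seteqP; split => x /= [Vx xn]; split => //; move: Vx; apply: dV => i _;
    by rewrite /set_coord; case: eqP => // ->.
have pV (P : process R bool) :
    fair P -> pr P V = pr P (W true) / 2 + pr P (W false) / 2.
  move=> fP; rewrite (prID P (measurable_bool_below dV) (measurable_bool_coord n true)).
  rewrite VW (fP n _ _ (dW _)); congr (_ + _).
  rewrite -(fP n _ false (dW _)) -VW; congr (pr P (_ `&` _)).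
  by apply/seteqP; split => x /=; case: (x n).
by rewrite !pV// !IH.
Qed.

Section binary_expansion.
Context (R : realType).

Definition doubling (x : R) : R := if x < 2^-1 then 2 * x else 2 * x - 1.

Definition binary_digits (x : R) : seqs bool := fun n => 2^-1 <= iter n doubling x.

Definition dyadic (w : seq bool) : R :=
  foldr (fun (b : bool) v => (b%:R + v) / 2) 0 w.

Lemma dyadic_bounds (w : seq bool) :
  0 <= dyadic w /\ dyadic w <= 1 - 2^-1 ^+ size w.
Proof.
elim: w => [|c v [IH0 IH1]] /=; first by rewrite expr0 subrr lexx.
move: IH0 IH1; rewrite exprS /dyadic /= -/(dyadic v).
by set e := _ ^+ _; case: c => /=; split; lra.
Qed.

(** The doubling map deletes the first digit; prefixing a digit halves the
    interval of the remaining ones. *)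
Lemma dyadic_interval (w : seq bool) (x : R) : 0 <= x < 1 ->
  (forall i, (i < size w)%N -> binary_digits x i = nth false w i) <->
  dyadic w <= x < dyadic w + 2^-1 ^+ size w.
Proof.
elim: w x => [|b w IH] x x01 /=; first by rewrite expr0 add0r.
have d01 : 0 <= doubling x < 1.
  move: x01 => /andP[x0 x1]; rewrite /doubling.
  by case: ltP => ?; apply/andP; split; lra.
have -> : (forall i, (i < (size w).+1)%N ->
      binary_digits x i = nth false (b :: w) i) <->
    binary_digits x 0 = b /\ (forall i, (i < size w)%N ->
      binary_digits (doubling x) i = nth false w i).
  split=> [H|[H0 H] [|i] //].
    split=> [|i iw]; first exact: (H 0%N).
    by have := H i.+1 iw; rewrite /binary_digits iterSr.
  by rewrite ltnS => /H; rewrite /binary_digits iterSr.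
have [dw0 dw1] := dyadic_bounds w.
move: x01 => /andP[x0 x1].
rewrite (IH _ d01) exprS; move: x0 x1 dw0 dw1.
rewrite /dyadic /= -/(dyadic w) /binary_digits /= /doubling; set e := _ ^+ _.
case: b => /=; case: (ltP x 2^-1) => ? ? ? ? ?.
- by split=> [[]//|/andP[? ?]]; exfalso; lra.
- split=> [[_ /andP[? ?]]|/andP[? ?]]; first by apply/andP; split; lra.
  by split=> //; apply/andP; split; lra.
- split=> [[_ /andP[? ?]]|/andP[? ?]]; first by apply/andP; split; lra.
  by split=> //; apply/andP; split; lra.
- by split=> [[]//|/andP[? ?]]; exfalso; lra.
Qed.

Lemma measurable_binary_digits :
  measurable_fun setT (binary_digits : measurableTypeR R -> seqs bool).
Proof.
apply: measurable_bool_seqs => n; rewrite /binary_digits.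
have mdbl : measurable_fun setT (doubling : measurableTypeR R -> measurableTypeR R).
  apply: measurable_fun_ifT => /=.
  - by apply: measurable_fun_ltr => //; exact: measurable_id.
  - exact: measurable_funM.
  - by apply: measurable_funB => //; exact: measurable_funM.
have miter : measurable_fun setT (fun x : measurableTypeR R => iter n doubling x).
  elim: n => [|n IH] /=; first exact: measurable_id.
  exact: (measurableT_comp mdbl IH).
rewrite (_ : mkset _ =
    (fun x : measurableTypeR R => iter n doubling x) @^-1` `[2^-1, +oo[).
  exact: measurable_fun_preimage.
by apply/seteqP; split => x /=; rewrite in_itv/= andbT.
Qed.

Lemma fair_cylinders (mu : process R bool) :
  (forall n (w : n.-tuple bool), pr mu [set x | block 0 n x = w] = 2^-1 ^+ n) ->
  fair mu.
Proof.
move=> mucyl n V b dV.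
have mV := measurable_bool_below dV.
have mB m (w : m.-tuple bool) : measurable [set x : seqs bool | block 0 m x = w].
  apply: (@measurable_bool_below m) => x y xy /= <-.
  by apply: eq_from_tnth => i; rewrite !tnth_mktuple add0n xy.
have mC := measurable_bool_coord n b.
rewrite (pr_partition mu (measurableI _ _ mV mC) (mB n)).
rewrite (pr_partition mu mV (mB n)) mulr_suml; apply: eq_bigr => w _.
pose xw : seqs bool := fun i => nth false w i.
have xwE x : block 0 n x = w -> forall i, (i < n)%N -> x i = xw i.
  move=> bx i ltin.
  rewrite /xw -bx -[i in RHS]/(nat_of_ord (Ordinal ltin)) -tnth_nth.
  by rewrite tnth_mktuple add0n.
have [Vw|nVw] := pselect (V xw).
  have sV x : block 0 n x = w -> V x.
    by move/xwE => xE; apply: dV Vw => i /xE.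
  rewrite (_ : V `&` _ `&` _ = [set x | block 0 n.+1 x = [tuple of rcons w b]]).
    rewrite (_ : V `&` _ = [set x | block 0 n x = w]); last first.
      by apply/seteqP; split => x /= => [[]//|xw']; split => //; exact: sV.
    by rewrite !mucyl exprS mulrC.
  apply/seteqP; split => x /=.
    move=> [[_ xn] /xwE xE]; apply: eq_from_tnth => i.
    rewrite tnth_mktuple (tnth_nth false) /= nth_rcons size_tuple add0n.
    have := ltn_ord i; rewrite ltnS.
    by case: (ltngtP i n) => [ltin _|//|-> _ //]; rewrite xE.
  move=> xE.
  have xE' i : (i < n.+1)%N -> x i = nth false (rcons w b) i.
    move=> ltin; move/(congr1 (fun t => tnth t (Ordinal ltin))): xE.
    by rewrite tnth_mktuple (tnth_nth false) /= add0n.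
  have bw : block 0 n x = w.
    apply: eq_from_tnth => i; rewrite tnth_mktuple (tnth_nth false) add0n.
    by rewrite (xE' i (ltnW (ltn_ord i))) nth_rcons size_tuple ltn_ord.
  split=> //; split; first exact: sV.
  by rewrite xE'// nth_rcons size_tuple ltnn eqxx.
have nV x : block 0 n x = w -> ~ V x.
  by move/xwE => xE Vx; apply: nVw; apply: dV Vx => i /xE.
rewrite [X in pr mu X](_ : _ = set0); last first.
  by apply/seteqP; split => // x [[Vx _] /nV].
rewrite [X in _ = pr mu X / _](_ : _ = set0) ?pr_set0 ?mul0r//.
by apply/seteqP; split => // x [Vx /nV].
Qed.

Lemma fair_exists : exists mu : process R bool, fair mu.
Proof.
have mI : measurable (`[0, 1[ : set (measurableTypeR R)) by exact: measurable_itv.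
pose m0 : {measure set (measurableTypeR R) -> \bar R} := mrestr lebesgue_measure mI.
have m0T : m0 setT = 1%E.
  by rewrite /m0/= /mrestr setTI lebesgue_measure_itv /= lte_fin ltr01 sube0.
pose P : probability (measurableTypeR R) R :=
  mnormalize m0 (dirac (0 : measurableTypeR R)).
have PE B : P B = m0 B.
  transitivity (mnormalize m0 (dirac (0 : measurableTypeR R)) B) => //.
  rewrite /mnormalize; case: ifPn => [/orP[] /eqP /(etrans (esym m0T)) // []|_].
    by move/eqP; rewrite oner_eq0.
  by rewrite m0T/= invr1 mule1.
have [mu muE] := mean_image P 0 (fun=> measurable_binary_digits).
exists mu; apply: fair_cylinders => n w.
rewrite muE; last first.
  apply: (@measurable_bool_below n) => x y xy /= <-.
  by apply: eq_from_tnth => i; rewrite !tnth_mktuple add0n xy.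
rewrite big_ord1 invr1 mul1r /pr PE /m0/= /mrestr.
have [dw0 dw1] := dyadic_bounds w; rewrite size_tuple in dw1.
rewrite (_ : _ `&` _ = `[dyadic w, dyadic w + 2^-1 ^+ n[%classic).
  rewrite lebesgue_measure_itv /= lte_fin ltrDl exprn_gt0 ?invr_gt0//.
  by rewrite EFinN -EFinB addrAC subrr add0r.
apply/seteqP; split => x /=; rewrite !in_itv/=.
  move=> [bx x01]; have [+ _] := dyadic_interval w x01; rewrite size_tuple; apply.
  move=> i ltin; rewrite -bx -[i in RHS]/(nat_of_ord (Ordinal ltin)) -tnth_nth.
  by rewrite tnth_mktuple add0n.
move=> xw; have x01 : 0 <= x < 1.
  by move: xw => /andP[? ?]; apply/andP; split; lra.
split=> //; have [_ +] := dyadic_interval w x01; rewrite size_tuple => /(_ xw) H.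
apply: eq_from_tnth => i; rewrite tnth_mktuple (tnth_nth false) add0n.
exact: H.
Qed.

End binary_expansion.

(** * Symmetries of the fair-coin process *)

Definition flip (c x : seqs bool) : seqs bool := fun n => x n (+) c n.

Definition unit_seq (n : nat) : seqs bool := fun i => i == n.

Definition reindex (f : nat -> nat) (x : seqs bool) : seqs bool :=
  fun n => x (f n).

Lemma measurable_flip (c : seqs bool) : measurable_fun setT (flip c).
Proof.
apply: measurable_bool_seqs => i.
rewrite (_ : mkset _ = [set x : seqs bool | x i = ~~ c i]).
  exact: measurable_bool_coord.
by apply/seteqP; split => x /=; rewrite /flip; case: (x i) (c i) => [] [].
Qed.

Lemma measurable_reindex (f : nat -> nat) : measurable_fun setT (reindex f).
Proof. by apply: measurable_bool_seqs => i; exact: measurable_bool_coord. Qed.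

Lemma flipK (c : seqs bool) : involutive (flip c).
Proof. by move=> x; apply/funext => i; rewrite /flip addbK. Qed.

Section fair_symmetries.
Context (R : realType) (mu : process R bool) (fair_mu : fair mu).

(** The image of [P] under [g] is then fair, and [mu] is the only fair law. *)
Lemma fair_pushforward d (T : measurableType d) (P : probability T R)
    (g : T -> seqs bool) :
  measurable_fun setT g ->
  (forall n (V : set (seqs bool)) b, depends_below n V ->
    pr P (g @^-1` (V `&` [set x | x n = b])) = pr P (g @^-1` V) / 2) ->
  forall B, measurable B -> pr P (g @^-1` B) = pr mu B.
Proof.
move=> mg fg B mB; have [nu nuE] := mean_image P 0 (fun=> mg).
have nuE' C : measurable C -> pr nu C = pr P (g @^-1` C).
  by move=> mC; rewrite nuE// big_ord1 invr1 mul1r.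
rewrite -nuE'// /pr (fair_unique _ fair_mu)// => n V b dV.
have mV := measurable_bool_below dV.
by rewrite !nuE' ?fg//; apply: measurableI => //; exact: measurable_bool_coord.
Qed.

Lemma fair_flip (c : seqs bool) B :
  measurable B -> pr mu (flip c @^-1` B) = pr mu B.
Proof.
apply: fair_pushforward; first exact: measurable_flip.
move=> n V b dV; rewrite -(@fair_mu n (flip c @^-1` V) (b (+) c n)); last first.
  by move=> x y xy; apply: dV => i ltin; rewrite /flip xy.
congr (pr mu (_ `&` _)); apply/seteqP; split => x /=; rewrite /flip.
  by move=> <-; rewrite addbK.
by move=> ->; rewrite addbK.
Qed.

(** Flipping one of the entries that [reindex f] reads preserves both [mu] and
    [A]. So, conditionally on [A], the reindexed sequence is still made of fair
    coins. *)
Lemma fair_indep (f : nat -> nat) (A B : set (seqs bool)) :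
  injective f -> measurable A -> measurable B ->
  (forall n x, A x -> A (flip (unit_seq (f n)) x)) ->
  pr mu (A `&` reindex f @^-1` B) = pr mu A * pr mu B.
Proof.
move=> injf mA mB Af.
have mg := measurable_reindex f.
have mI C : measurable C -> measurable (A `&` reindex f @^-1` C).
  by move=> mC; apply: measurableI => //; exact: measurable_fun_preimage.
have [A0|A0] := eqVneq (pr mu A) 0.
  rewrite A0 mul0r; apply/eqP; rewrite eq_le pr_ge0 andbT -A0.
  by apply: le_pr => //; exact: mI.
pose m0 : {measure set (seqs bool) -> \bar R} := mrestr mu mA.
have m0E C : m0 C = mu (C `&` A) by [].
have m0T : m0 setT = (pr mu A)%:E by rewrite m0E setTI prE.
pose P : process R bool := mnormalize m0 mu.
have PE C : measurable C -> pr P C = pr mu (A `&` C) / pr mu A.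
  move=> mC; rewrite {1}/pr.
  have -> : P C = (m0 C * (fine (m0 setT))^-1%:E)%E.
    transitivity (mnormalize m0 mu C) => //.
    rewrite /mnormalize; case: ifPn => // /orP[] /eqP /(etrans (esym m0T)) // [].
    by move/eqP; rewrite (negbTE A0).
  by rewrite m0T m0E setIC prE//; exact: measurableI.
have : pr P (reindex f @^-1` B) = pr mu B.
  apply: fair_pushforward => // n V b dV.
  have mV := measurable_bool_below dV.
  have mVb c : measurable (V `&` [set x | x n = c]).
    by apply: measurableI => //; exact: measurable_bool_coord.
  have mgp C : measurable C -> measurable (reindex f @^-1` C).
    by move=> mC; exact: measurable_fun_preimage.
  have e : pr mu (A `&` reindex f @^-1` (V `&` [set x | x n = ~~ b])) =
           pr mu (A `&` reindex f @^-1` (V `&` [set x | x n = b])).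
    rewrite -(fair_flip (unit_seq (f n)) (mI _ (mVb b))).
    congr (pr mu _); apply/seteqP; split => x /=.
      move=> [Ax [Vx xn]]; split; first exact: Af.
      split; last first.
        by rewrite /reindex /flip /unit_seq eqxx -[x _]/(reindex f x n) xn; case: (b).
      apply: dV Vx => i ltin; rewrite /reindex /flip /unit_seq.
      by rewrite (inj_eq injf) ltn_eqF// addbF.
    move=> [Ax [Vx]]; rewrite /reindex /flip /unit_seq eqxx addbT => xn.
    split; first by rewrite -[x](flipK (unit_seq (f n))); exact: Af.
    split; last by rewrite -xn negbK.
    apply: dV Vx => i ltin; rewrite /reindex /flip /unit_seq.
    by rewrite (inj_eq injf) ltn_eqF// addbF.
  rewrite !PE; [|exact: mgp..].
  rewrite (prID mu (mI _ mV) (mgp _ (measurable_bool_coord n b))).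
  rewrite [X in _ = (X + _) / _ / _](_ : _ =
    pr mu (A `&` reindex f @^-1` (V `&` [set x | x n = b]))); last first.
    by congr (pr mu _); rewrite preimage_setI setIA.
  rewrite [X in _ = (_ + X) / _ / _](_ : _ =
    pr mu (A `&` reindex f @^-1` (V `&` [set x | x n = ~~ b]))); last first.
    congr (pr mu _); rewrite preimage_setI setIA; congr (_ `&` _).
    apply/seteqP; split => x /=; rewrite /reindex.
      by case: (x (f n)) (b) => [] [] //; case.
    by case: (x (f n)) (b) => [] [].
  by rewrite e; field.
by rewrite PE; [move=> <-; rewrite mulrC divfK|exact: measurable_fun_preimage].
Qed.

End fair_symmetries.

(** * Rows of a sequence *)

(** Every index is [2 ^ t * i.*2.+1 - 1] for a unique row [t] and a unique
    position [i] in that row. Row 0 is the set of even indices, and the entries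
    of all later rows, in order, form the odd indices, so that dropping rows is
    again a reindexing. *)
Definition row_index (t i : nat) : nat := (2 ^ t * i.+1).-1.

Definition drop_rows (t : nat) : seqs bool -> seqs bool := reindex (row_index t).

Lemma row_indexS t i : (row_index t i).+1 = (2 ^ t * i.+1)%N.
Proof. by rewrite /row_index prednK// muln_gt0 expn_gt0. Qed.

Lemma row_index_inj t : injective (row_index t).
Proof.
move=> i j /(congr1 S); rewrite !row_indexS => /eqP.
by rewrite eqn_pmul2l ?expn_gt0// => /eqP[].
Qed.

Lemma drop_rows0 x : drop_rows 0 x = x.
Proof. by apply/funext => i; rewrite /drop_rows /reindex /row_index mul1n. Qed.

Lemma drop_rowsD s t x : drop_rows s (drop_rows t x) = drop_rows (s + t) x.
Proof.
apply/funext => i; rewrite /drop_rows /reindex; congr (x _); apply: succn_inj.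
by rewrite !row_indexS mulnA -expnD addnC.
Qed.

(** The indices of the rows [>= n] are the predecessors of the multiples of
    [2 ^ n]. *)
Definition same_rows (n : nat) (x y : seqs bool) :=
  forall i, ~~ (2 ^ n %| i.+1)%N -> x i = y i.

Definition depends_rows (n : nat) (V : set (seqs bool)) :=
  forall x y, same_rows n x y -> V x -> V y.

Lemma same_rows_drop_rows n t x y :
  same_rows n x y -> same_rows (n - t) (drop_rows t x) (drop_rows t y).
Proof.
move=> xy i; have [letn|ltnt] := leqP t n => ni.
  apply: xy; rewrite row_indexS -(subnKC letn) expnD dvdn_pmul2l ?expn_gt0//.
by move: ni; rewrite (eqP (ltnW ltnt : (n - t == 0)%N)) dvd1n.
Qed.

Lemma same_rows_row0 n x y i : same_rows n.+1 x y -> x i.*2 = y i.*2.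
Proof.
move=> xy; apply: xy; apply/negP => /(dvdn_trans (dvdn_exp (ltn0Sn n) (dvdnn 2))).
by rewrite dvdn2 /= odd_double.
Qed.

Lemma same_rows_le m n x y : (m <= n)%N -> same_rows n x y -> same_rows m x y.
Proof.
move=> lemn xy i mi; apply: xy; apply: contra mi; apply: dvdn_trans.
exact: dvdn_exp2l.
Qed.

Lemma depends_below_rows n V : depends_below n V -> depends_rows n V.
Proof.
move=> dV x y xy; apply: dV => i ltin; apply: xy.
by rewrite gtnNdvd// (leq_ltn_trans ltin)// ltn_expl.
Qed.

Section row_independence.
Context (R : realType) (mu : process R bool) (fair_mu : fair mu).

Lemma measurable_drop_rows t : measurable_fun setT (drop_rows t).
Proof. exact: measurable_reindex. Qed.

Lemma measurable_preimage_drop_rows t B :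
  measurable B -> measurable (drop_rows t @^-1` B).
Proof. exact: measurable_fun_preimage (measurable_drop_rows t). Qed.

Lemma fair_rows n (A B : set (seqs bool)) :
  measurable A -> measurable B -> depends_rows n A ->
  pr mu (A `&` drop_rows n @^-1` B) = pr mu A * pr mu B.
Proof.
move=> mA mB dA.
apply: (fair_indep fair_mu (@row_index_inj n) mA mB).
move=> i x; apply: dA => j nj; rewrite /flip /unit_seq; case: eqP => [ji|_].
  by move: nj; rewrite ji row_indexS dvdn_mulr.
by rewrite addbF.
Qed.

Lemma fair_drop_rows n (B : set (seqs bool)) :
  measurable B -> pr mu (drop_rows n @^-1` B) = pr mu B.
Proof.
move=> mB; rewrite -[drop_rows n @^-1` B]setTI fair_rows//.
by rewrite pr_setT mul1r.
Qed.

End row_independence.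

(** * Processes driven by fair coins and a finite phase *)

Definition coin (x : seqs bool) : bool := x 2%N.

(** The phase counts down the remaining symbols of the current block, whose
    length is [L]; phase 0 is idle. After phase 1 as well as after an idle time,
    a coin decides between idling and the start of a block. *)
Definition step (L a : nat) (e : bool) : nat :=
  if (a <= 1)%N then (if e then 0 else L)%N else a.-1.

Fixpoint phase (L a : nat) (x : seqs bool) (t : nat) : nat :=
  if t is t'.+1 then step L (phase L a x t') (coin (drop_rows t' x)) else a.

Definition itinerary (A : ptopologicalType) (L : nat) (f : nat -> seqs bool -> A)
    (a : nat) (x : seqs bool) : seqs A :=
  fun t => f (phase L a x t) (drop_rows t x).

Lemma phaseD L a x s t :
  phase L a x (s + t) = phase L (phase L a x s) (drop_rows s x) t.
Proof.
elim: t => [|t IH]; first by rewrite addn0.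
by rewrite addnS /= IH drop_rowsD [(t + s)%N]addnC.
Qed.

Lemma itineraryD (A : ptopologicalType) L (f : nat -> seqs bool -> A) a x s t :
  itinerary L f a x (s + t) = itinerary L f (phase L a x s) (drop_rows s x) t.
Proof. by rewrite /itinerary phaseD drop_rowsD [(t + s)%N]addnC. Qed.

Lemma phase_le L a x t : (a <= L)%N -> (phase L a x t <= L)%N.
Proof.
move=> aL; elim: t => //= t IH; rewrite /step.
by case: ifP => _; [case: ifP|exact: leq_trans (leq_pred _) IH].
Qed.

Section law.
Context (R : realType) (mu : process R bool) (fair_mu : fair mu).

Lemma pr_coin b : pr mu [set x | coin x = b] = 2^-1.
Proof.
rewrite -[X in pr mu X]setTI (@fair_mu 2 setT b) ?pr_setT ?mul1r//.
Qed.

Lemma measurable_coin b : measurable [set x : seqs bool | coin x = b].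
Proof. exact: measurable_bool_coord. Qed.

Lemma coin_rows b n : depends_rows n.+1 [set x | coin x = b].
Proof. by move=> x y xy /= <-; apply/esym/(same_rows_row0 1 xy). Qed.

Lemma pr_step_coin (C : nat -> set (seqs bool)) L :
  (forall a, measurable (C a)) ->
  pr mu [set x | C (if coin x then 0 else L)%N (drop_rows 1 x)] =
  pr mu (C 0%N) / 2 + pr mu (C L) / 2.
Proof.
move=> mC; set V := mkset _.
have VE b : V `&` [set x | coin x = b] =
    [set x | coin x = b] `&` drop_rows 1 @^-1` C (if b then 0 else L)%N.
  by apply/seteqP; split => x /= [] => [+ /[dup] e ->|/[dup] e -> +]; rewrite /V /= ?e.
have mE b :
    measurable ([set x | coin x = b] `&` drop_rows 1 @^-1` C (if b then 0 else L)%N).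
  by apply: measurableI; [exact: measurable_coin|exact: measurable_preimage_drop_rows].
have VU : V = (V `&` [set x | coin x = true]) `|` (V `&` [set x | coin x = false]).
  rewrite -setIUr; apply/esym/setIidPl => x _ /=.
  by case: (coin x); [left|right].
rewrite VU prU; last 3 first.
- by rewrite VE.
- by rewrite VE.
- by apply/seteqP; split => // x /= [[_ ->] []].
rewrite !VE !(fair_rows fair_mu) ?pr_coin//; try exact: measurable_coin;
  try exact: coin_rows.
by rewrite ![2^-1 * _]mulrC.
Qed.

(** The uniform distribution on the phases is stationary because the two phases
    0 and 1 share their successors 0 and [L], each with probability 1/2, and
    every other phase is entered from exactly one phase. *)
Lemma sum_pr_step (C : nat -> set (seqs bool)) L :
  (forall a, measurable (C a)) ->
  \sum_(a < L.+1) pr mu [set x | C (step L a (coin x)) (drop_rows 1 x)] =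
  \sum_(a < L.+1) pr mu (C a).
Proof.
move=> mC; case: L => [|L].
  rewrite !big_ord1 -(fair_drop_rows fair_mu 1 (mC 0%N)); congr (pr mu _).
  by apply/seteqP; split => x /=; rewrite /step if_same.
rewrite [LHS]big_ord_recl [in LHS]big_ord_recl.
rewrite [RHS]big_ord_recl [in RHS]big_ord_recr /=.
rewrite /step/= /bump/= !(pr_step_coin _ mC).
rewrite (eq_bigr (fun i : 'I_L => pr mu (C (lift ord0 (widen_ord (leqnSn L) i)))));
  last first.
  by move=> i _; rewrite -(fair_drop_rows fair_mu 1 (mC _)).
by rewrite /bump /=; lra.
Qed.

Section alphabet.
Context (A : ptopologicalType) (finA : finite_set [set: A])
  (openA : forall B : set A, open B).
Implicit Types (f : nat -> seqs bool -> A).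

Definition measurable_letters f := forall a c, measurable [set x | f a x = c].

Lemma measurable_phase L a t n : measurable [set x | phase L a x t = n].
Proof.
elim: t n => [|t IH] n /=.
  exact: measurable_const.
rewrite (_ : mkset _ = \bigcup_m ([set x | phase L a x t = m] `&`
  (\bigcup_b ([set x | step L m b = n] `&` drop_rows t @^-1` [set x | coin x = b])))).
  apply: bigcup_measurable => m _; apply: measurableI; first exact: IH.
  apply: fin_bigcup_measurable; first exact: finite_bool.
  move=> b _; apply: measurableI; first exact: measurable_const.
  by apply: measurable_preimage_drop_rows; exact: measurable_coin.
apply/seteqP; split => x /=.
  by move=> e; exists (phase L a x t) => //; split => //; exists (coin (drop_rows t x)).
by move=> [m _ [<- [b _ [<- <-]]]].
Qed.

Lemma measurable_itinerary L f a :
  measurable_letters f -> measurable_fun setT (itinerary L f a).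
Proof.
move=> mf; apply: (measurable_fun_seqs finA openA) => t c.
rewrite (_ : mkset _ = \bigcup_m ([set x | phase L a x t = m] `&`
  drop_rows t @^-1` [set x | f m x = c])).
  apply: bigcup_measurable => m _; apply: measurableI; first exact: measurable_phase.
  exact: measurable_preimage_drop_rows.
apply/seteqP; split => x /=; last by move=> [m _ [<- ]].
by move=> e; exists (phase L a x t).
Qed.

(** The process whose phase is initially uniform on [0, ..., L] and whose symbol
    is a function [f] of the phase and of the rows that are still to come. *)
Definition is_law L f (Q : process R A) := forall B, measurable B ->
  pr Q B = L.+1%:R^-1 * \sum_(a < L.+1) pr mu (itinerary L f a @^-1` B).

Lemma law_exists L f : measurable_letters f -> exists Q, is_law L f Q.
Proof.
by move=> mf; apply: mean_image => a; exact: measurable_itinerary.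
Qed.

Lemma measurable_time_shift : measurable_fun setT (@time_shift A).
Proof.
apply: (measurable_fun_seqs finA openA) => i a.
exact: (@measurable_coord _ openA i.+1 [set a]).
Qed.

(** One step of time moves the pair of the phase and the remaining rows, and by
    [sum_pr_step] this leaves the initial distribution invariant. *)
Lemma law_stationary L f Q : measurable_letters f -> is_law L f Q -> stationary Q.
Proof.
move=> mf QE B mB.
have mTB : measurable (@time_shift A @^-1` B).
  exact: measurable_fun_preimage measurable_time_shift mB.
rewrite !prE// !QE//; congr (_ * _)%:E.
have mC a : measurable (itinerary L f a @^-1` B).
  exact: measurable_fun_preimage (measurable_itinerary L a mf) mB.
rewrite -(sum_pr_step L mC); apply: eq_bigr => a _; congr (pr mu _).
suff e x : time_shift (itinerary L f a x) =
    itinerary L f (step L a (coin x)) (drop_rows 1 x).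
  by apply/seteqP; split => x /=; rewrite e.
apply/funext => t; rewrite -[LHS]/(itinerary L f a x (1 + t)).
by rewrite itineraryD /= drop_rows0.
Qed.

Lemma law_phase_free L (g : seqs bool -> A) Q :
  is_law 0 (fun=> g) Q -> is_law L (fun=> g) Q.
Proof.
move=> QE B mB; rewrite QE// big_ord1 invr1 mul1r.
rewrite [X in _ = _ * X](eq_bigr (fun=> pr mu (itinerary 0 (fun=> g) 0 @^-1` B)))//.
by rewrite sumr_const card_ord -[X in _ = _ * X]mulr_natl mulKf// pnatr_eq0.
Qed.

End alphabet.

Lemma measurable_letters_pair (f1 f2 : nat -> seqs bool -> bool) :
  measurable_letters f1 -> measurable_letters f2 ->
  measurable_letters (fun a x => (f1 a x, f2 a x)).
Proof.
move=> mf1 mf2 a [c1 c2].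
rewrite (_ : mkset _ = [set x | f1 a x = c1] `&` [set x | f2 a x = c2]).
  by apply: measurableI; [exact: mf1|exact: mf2].
by apply/seteqP; split => x /= [-> ->].
Qed.

(** Two processes driven by the same coins and the same phase are joined by
    observing them together. *)
Lemma law_joining L (f1 f2 : nat -> seqs bool -> bool) (P Q : process R bool)
    (nu : process R (bool * bool)%type) :
  measurable_letters f1 -> measurable_letters f2 ->
  is_law L f1 P -> is_law L f2 Q -> is_law L (fun a x => (f1 a x, f2 a x)) nu ->
  stationary_joining P Q nu.
Proof.
move=> mf1 mf2 PE QE nuE.
have mf := measurable_letters_pair mf1 mf2.
have ml : measurable_fun setT (@left_seq bool bool).
  apply: measurable_bool_seqs => i.
  exact: (@measurable_coord _ open_bool2 i [set c : bool * bool | c.1]).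
have mr : measurable_fun setT (@right_seq bool bool).
  apply: measurable_bool_seqs => i.
  exact: (@measurable_coord _ open_bool2 i [set c : bool * bool | c.2]).
split.
- exact: (law_stationary finite_bool2 open_bool2 mf nuE).
- move=> B mB; rewrite !prE//; last exact: measurable_fun_preimage.
  by rewrite PE// nuE//; exact: measurable_fun_preimage.
- move=> B mB; rewrite !prE//; last exact: measurable_fun_preimage.
  by rewrite QE// nuE//; exact: measurable_fun_preimage.
Qed.

Lemma law_dbar_le L (f1 f2 : nat -> seqs bool -> bool) (P Q : process R bool)
    (e : R) :
  measurable_letters f1 -> measurable_letters f2 ->
  is_law L f1 P -> is_law L f2 Q ->
  L.+1%:R^-1 * \sum_(a < L.+1) pr mu [set x | f1 a x <> f2 a x] <= e ->
  (dbar P Q <= e%:E)%E.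
Proof.
move=> mf1 mf2 PE QE le_e.
have mf := measurable_letters_pair mf1 mf2.
have [nu nuE] := law_exists finite_bool2 open_bool2 L mf.
apply: ereal_inf_lbound; exists e => //=; exists nu; split.
  exact: law_joining nuE.
have mneq := @measurable_coord _ open_bool2 0 [set c : bool * bool | c.1 <> c.2].
rewrite prE; last exact: mneq.
rewrite nuE; last exact: mneq.
rewrite lee_fin (le_trans _ le_e)// ler_pM2l ?invr_gt0 ?ltr0n//.
rewrite le_eqVlt; apply/orP; left; apply/eqP; apply: eq_bigr => a _.
by congr (pr mu _); apply/seteqP; split => x /=; rewrite /itinerary /= drop_rows0.
Qed.

End law.

(** * Block codes with visible phase *)

Section block_coding.
Context (L m : nat) (m_gt0 : (0 < m)%N) (ltmL : (m < L)%N).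
Variable psi : nat -> seqs bool -> bool.
Hypothesis psi_rows : forall a x y, same_rows a.-1 x y -> psi a x = psi a y.

(** The block of length [L] starts with the symbol 0, repeats a 0 every [m]
    symbols, and ends with [m] symbols 1; idle symbols are 1 too. Thus [m]
    consecutive 1s followed by a 0 occur exactly at the starts of blocks. The
    remaining positions carry the content [psi], which at phase [a] may look
    [a.-1] rows ahead, that is, strictly before the row whose coin decides what
    follows the block. *)
Definition block_code (a : nat) (x : seqs bool) : bool :=
  if (a <= m)%N then true else if (m %| L - a)%N then false else psi a x.

Lemma block_code0 x : block_code 0 x = true.
Proof. by []. Qed.

Lemma block_codeL x : block_code L x = false.
Proof. by rewrite /block_code leqNgt ltmL /= subnn dvdn0. Qed.

Lemma phase_before_start a x t i : (a <= L)%N -> (0 < i <= t)%N ->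
  phase L a x t = L -> (phase L a x (t - i) <= i)%N.
Proof.
move=> aL; case: i => // i; rewrite /= => /[swap] pL; elim: i => [|i IH] lit.
  case: t pL lit => // t pL _; rewrite subn1 /=.
  by move: pL (phase_le x t aL); rewrite /= /step; case: ifP => // _ ?; lia.
have {IH} := IH (ltnW lit); rewrite (_ : t - i.+1 = (t - i.+2).+1)%N /=; last lia.
by rewrite /step; case: ifP => ? //; lia.
Qed.

Lemma phase_before_idle a x t i : (i <= t)%N ->
  (phase L a x t <= 1)%N -> (phase L a x (t - i) <= i.+1)%N.
Proof.
move=> + p1; elim: i => [|i IH] lit; first by rewrite subn0.
have {IH} := IH (ltnW lit); rewrite (_ : t - i = (t - i.+1).+1)%N /=; last lia.
by rewrite /step; case: ifP => ? //; lia.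
Qed.

Lemma phase_back a x t i : (i <= t)%N -> (0 < phase L a x t)%N ->
  (phase L a x t + i <= L)%N -> (phase L a x (t - i) = phase L a x t + i)%N.
Proof.
move=> + p0; elim: i => [|i IH] lit pL; first by rewrite subn0 addn0.
have := IH (ltnW lit) ltac:(lia); rewrite (_ : t - i = (t - i.+1).+1)%N /=; last lia.
by rewrite /step; case: ifP => ?; [case: ifP => ?|]; lia.
Qed.

(** If a 0 is read inside a block, then one of the [m] positions before it is the
    start of the block or one of its periodic 0s, so they are not all 1. *)
Lemma start_visible a x t : (a <= L)%N -> (m <= t)%N ->
  phase L a x t = L <->
  (itinerary L block_code a x t = false /\
   forall i, (0 < i <= m)%N -> itinerary L block_code a x (t - i)%N = true).
Proof.
move=> aL lmt; split=> [pL|[z0 z1]].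
  split=> [|i /andP[i0 im]]; first by rewrite /itinerary pL block_codeL.
  rewrite /itinerary /block_code (leq_trans (phase_before_start aL _ pL))//.
  by rewrite i0 (leq_trans im).
have lpL := phase_le x t aL; have := z0; rewrite /itinerary /block_code.
case: leqP => // ltmp; case: ifP => // dm _; apply/eqP.
  rewrite eqn_leq lpL /=; apply: contraT; rewrite -ltnNge => ltpL.
  have lem := dvdn_leq (ltac:(lia) : 0 < L - phase L a x t)%N dm.
  have := z1 m ltac:(lia); rewrite /itinerary /block_code phase_back; try lia.
  rewrite leqNgt (_ : m < _)%N; last by lia.
  by rewrite /= subnDA (dvdn_sub dm (dvdnn m)).
rewrite eqn_leq lpL /=; apply: contraT; rewrite -ltnNge => ltpL.
(* The last periodic 0 before time t is r symbols earlier. *)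
set r := ((L - phase L a x t) %% m)%N.
have r0 : (0 < r)%N by rewrite lt0n; apply: contraFN dm; rewrite /dvdn.
have rm : (r < m)%N by rewrite ltn_mod.
have rL : (r <= L - phase L a x t)%N by exact: leq_mod.
have := z1 r ltac:(lia); rewrite /itinerary /block_code phase_back; try lia.
rewrite leqNgt (_ : m < _)%N; last by lia.
rewrite /= subnDA (_ : (m %| _)%N = true)//.
by rewrite [X in (X - _)%N](divn_eq (L - phase L a x t) m) -/r addnK dvdn_mull.
Qed.

(** Starts of blocks are visible from time [m] on, hence simultaneous in the two
    runs. A common start makes the phases agree for ever, and without any start
    both phases have counted down to 0 after [L] steps. *)
Lemma same_word_same_phase a a' x x' : (a <= L)%N -> (a' <= L)%N ->
  (forall t, (t < L + m.+1)%N ->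
    itinerary L block_code a x t = itinerary L block_code a' x' t) ->
  phase L a x (L + m) = phase L a' x' (L + m).
Proof.
move=> aL a'L zz.
have startE t : (m <= t)%N -> (t < L + m.+1)%N ->
    phase L a x t = L <-> phase L a' x' t = L.
  move=> lmt ltt; rewrite !start_visible// zz//.
  split=> [] [-> H]; split => // i ib; have lt : (t - i < L + m.+1)%N by lia.
    by rewrite -zz// H.
  by rewrite zz// H.
suff H j : (j <= L)%N ->
    phase L a x (m + j) = phase L a' x' (m + j) \/
    (phase L a x (m + j) <= L - j)%N /\ (phase L a' x' (m + j) <= L - j)%N.
  by have := H L (leqnn L); rewrite [(m + L)%N]addnC; lia.
elim: j => [_|j IH ltjL]; first by right; rewrite subn0 !phase_le.
have := startE (m + j.+1)%N ltac:(lia) ltac:(lia).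
have := IH (ltnW ltjL); rewrite addnS /=.
rewrite /step; move: (phase L a x _) (phase L a' x' _) (coin _) (coin _).
by move=> p p' e e'; case: (leqP p 1) => ?; case: (leqP p' 1) => ?;
  case: e; case: e'; lia.
Qed.

Lemma phase_rows a n x y t : same_rows n x y -> (t <= n)%N ->
  phase L a x t = phase L a y t.
Proof.
move=> xy; elim: t => //= t IH ltn; rewrite IH; last exact: ltnW.
congr step; have := @same_rows_drop_rows _ t _ _ xy.
rewrite (_ : n - t = (n - t).-1.+1)%N; last lia.
by move/(same_rows_row0 1).
Qed.

Lemma block_code_rows a n x y :
  same_rows n x y -> (a <= n.+1)%N -> block_code a x = block_code a y.
Proof.
move=> xy an; rewrite /block_code; case: ifP => // _; case: ifP => // _.
by apply: psi_rows; apply: same_rows_le xy; lia.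
Qed.

Lemma itinerary_rows a n x y t : (a <= L)%N -> same_rows n x y -> (t + L <= n)%N ->
  itinerary L block_code a x t = itinerary L block_code a y t.
Proof.
move=> aL xy tn; rewrite /itinerary (phase_rows a xy); last lia.
have pL := phase_le y t aL.
by apply: (block_code_rows (@same_rows_drop_rows _ t _ _ xy)); lia.
Qed.

Definition word_event (a n : nat) (w : nat -> bool) : set (seqs bool) :=
  [set x | forall t, (t < n)%N -> itinerary L block_code a x t = w t].

Lemma word_event_rows a n w : (a <= L)%N -> depends_rows (n + L) (word_event a n w).
Proof.
by move=> aL x y xy xw t ltn; rewrite -xw// (itinerary_rows aL xy)//; lia.
Qed.

(** The phases before the start of a block leave no room to look beyond it. *)
Lemma word_event_start_rows a s w : (a <= L)%N ->
  depends_rows s (word_event a s w `&` [set x | phase L a x s = L]).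
Proof.
move=> aL x y xy [xw xL]; have yL : phase L a y s = L by rewrite -(phase_rows a xy).
split=> // t ltts; rewrite -xw// /itinerary (phase_rows a xy); last lia.
have := phase_before_start aL (ltac:(lia) : 0 < s - t <= s)%N yL.
rewrite subKn; last lia.
move=> ?; apply/esym/(block_code_rows (@same_rows_drop_rows _ t _ _ xy)); lia.
Qed.

Lemma word_event_idle_rows a u w :
  depends_rows u (word_event a u.+1 w `&` [set x | (phase L a x u <= 1)%N]).
Proof.
move=> x y xy [xw x1]; have y1 : (phase L a y u <= 1)%N by rewrite -(phase_rows a xy).
split=> // t ltts; rewrite -xw// /itinerary (phase_rows a xy); last lia.
have := phase_before_idle (ltac:(lia) : u - t <= u)%N y1; rewrite subKn; last lia.
move=> ?; apply/esym/(block_code_rows (@same_rows_drop_rows _ t _ _ xy)); lia.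
Qed.

Section block_code_law.
Context (R : realType) (mu : process R bool) (fair_mu : fair mu).
Hypothesis mpsi : measurable_letters psi.

Lemma measurable_block_code : measurable_letters block_code.
Proof.
move=> a c; rewrite /block_code; case: (a <= m)%N; first exact: measurable_const.
by case: (m %| L - a)%N => //; exact: measurable_const.
Qed.

Lemma measurable_itinerary_letter a t c :
  measurable [set x | itinerary L block_code a x t = c].
Proof.
exact: (measurable_fun_preimage
  (measurable_itinerary finite_bool open_bool L a measurable_block_code)
  (measurable_bool_coord t c)).
Qed.

Lemma measurable_word_event a n w : measurable (word_event a n w).
Proof.
rewrite (_ : word_event a n w =
    \bigcap_(t < n) [set x | itinerary L block_code a x t = w t]).
  by apply: bigcap_measurableType => t _; exact: measurable_itinerary_letter.
by apply/seteqP; split.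
Qed.

Lemma pr_word_event_idle a u w c :
  (forall x, word_event a u.+1 w x -> phase L a x u <= 1)%N ->
  pr mu (word_event a u.+1 w `&` [set x | itinerary L block_code a x u.+1 = c]) =
  pr mu (word_event a u.+1 w) / 2.
Proof.
move=> w1; have wE : word_event a u.+1 w =
    word_event a u.+1 w `&` [set x | (phase L a x u <= 1)%N].
  by apply/esym/setIidPl => x; exact: w1.
transitivity (pr mu (word_event a u.+1 w `&` drop_rows u @^-1` [set x | coin x = c])).
  congr (pr mu _); apply/seteqP; split => x /= [xw].
    move=> <-; split => //; rewrite /itinerary /= /step w1//.
    by case: (coin _); rewrite ?block_codeL ?block_code0.
  move=> <-; split => //; rewrite /itinerary /= /step w1//.
  by case: (coin _); rewrite ?block_codeL ?block_code0.
rewrite (fair_rows fair_mu) ?pr_coin//.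
- exact: measurable_word_event.
- exact: measurable_coin.
- by rewrite wE; exact: word_event_idle_rows.
Qed.

Lemma pr_word_event_start a s k w (V : set (seqs bool)) : (a <= L)%N ->
  measurable V ->
  (forall x, word_event a (s + k) w x -> phase L a x s = L) ->
  pr mu (word_event a (s + k) w `&` drop_rows s @^-1` V) =
  pr mu (word_event a s w `&` [set x | phase L a x s = L]) *
  pr mu (word_event L k (fun t => w (s + t)%N) `&` V).
Proof.
move=> aL mV wL.
rewrite -(fair_rows fair_mu (n := s)); last 3 first.
- apply: measurableI; [exact: measurable_word_event|exact: measurable_phase].
- by apply: measurableI => //; exact: measurable_word_event.
- exact: word_event_start_rows.
congr (pr mu _); apply/seteqP; split => x /=.
  move=> [xw xV]; have xL := wL _ xw; split; split => //.
    by move=> t tk; apply: xw; lia.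
  by move=> t tk; rewrite -xw ?ltn_add2l// itineraryD xL.
move=> [[xw xL] [xw' xV]]; split => // t tk.
have [/xw//|lst] := ltnP t s.
by rewrite -(subnKC lst) itineraryD xL xw'//; lia.
Qed.

(** The Markov property in cross-multiplied form, for two pasts with the same last
    [L + m.+1] symbols. These determine the phase. If it is at most 1, the next
    symbol is a new coin. Otherwise the current block began inside the common
    part, it is independent of what came before, and its conditional law given
    the symbols already read is the same for both pasts. *)
Lemma word_event_cross a a' n w w' c : (a <= L)%N -> (a' <= L)%N ->
  (L + m.+1 <= n)%N ->
  (forall t, (n - (L + m.+1) <= t < n)%N -> w t = w' t) ->
  pr mu (word_event a n w `&` [set x | itinerary L block_code a x n = c]) *
    pr mu (word_event a' n w') =
  pr mu (word_event a' n w' `&` [set x | itinerary L block_code a' x n = c]) *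
    pr mu (word_event a n w).
Proof.
move=> aL a'L Ln ww'.
have pr0 b v : pr mu (word_event b n v) = 0 ->
    pr mu (word_event b n v `&` [set x | itinerary L block_code b x n = c]) = 0.
  move=> v0; apply/eqP; rewrite eq_le pr_ge0 andbT -v0 le_pr//.
    apply: measurableI; first exact: measurable_word_event.
    exact: measurable_itinerary_letter.
  exact: measurable_word_event.
have [w0|w0] := eqVneq (pr mu (word_event a n w)) 0.
  by rewrite (pr0 _ _ w0) w0 mulr0 mul0r.
have [w'0|w'0] := eqVneq (pr mu (word_event a' n w')) 0.
  by rewrite (pr0 _ _ w'0) w'0 mulr0 mul0r.
have ex b v : pr mu (word_event b n v) != 0 -> exists x, word_event b n v x.
  move=> v0; apply: contrapT => /forallNP nv; move: v0.
  rewrite (_ : word_event b n v = set0) ?pr_set0 ?eqxx//.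
  by apply/seteqP; split => // x /nv.
have [x0 x0w] := ex _ _ w0; have [x1 x1w] := ex _ _ w'0.
have eqp x y : word_event a n w x -> word_event a' n w' y ->
    phase L a x n.-1 = phase L a' y n.-1.
  move=> xw yw; pose s := (n - (L + m.+1))%N.
  rewrite (_ : n.-1 = s + (L + m))%N; last by rewrite /s; lia.
  rewrite [LHS]phaseD [RHS]phaseD; apply: same_word_same_phase; try exact: phase_le.
  move=> t lt; rewrite -!itineraryD xw; last by rewrite /s; lia.
  by rewrite yw; [apply: ww'; rewrite /s; lia|rewrite /s; lia].
set al := phase L a x0 n.-1.
have wal x : word_event a n w x -> phase L a x n.-1 = al.
  by move=> xw; rewrite (eqp x x1)// -(eqp x0 x1).
have w'al x : word_event a' n w' x -> phase L a' x n.-1 = al.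
  by move=> xw; rewrite -(eqp x0 x).
have alL : (al <= L)%N by exact: phase_le.
have [al1|al1] := leqP al 1.
  case: n Ln ww' {pr0 w0 w'0 ex} x0w x1w eqp @al wal w'al alL al1 => [|u]; first by lia.
  move=> Ln ww' x0w x1w eqp al wal w'al alL al1.
  rewrite !pr_word_event_idle; first by ring.
    by move=> x /w'al /= ->.
  by move=> x /wal /= ->.
pose s := (n.-1 - (L - al))%N; pose k := (L - al).+1.
have nE : n = (s + k)%N by rewrite /s /k; lia.
have start b v : (forall x, word_event b n v x -> phase L b x n.-1 = al) ->
    forall x, word_event b (s + k) v x -> phase L b x s = L.
  rewrite -nE => val x /val xal.
  by rewrite /s phase_back ?xal; lia.
have zE b v : (b <= L)%N ->
    (forall x, word_event b n v x -> phase L b x n.-1 = al) ->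
    pr mu (word_event b n v `&` [set x | itinerary L block_code b x n = c]) =
    pr mu (word_event b s v `&` [set x | phase L b x s = L]) *
    pr mu (word_event L k (fun t => v (s + t)%N) `&`
      [set x | itinerary L block_code L x k = c]).
  move=> bL val; have st := start b v val; rewrite -pr_word_event_start//; last first.
    exact: measurable_itinerary_letter.
  rewrite -nE; congr (pr mu _); apply/seteqP; split => x /= [xv] => [<-|]; split => //.
    by rewrite [in RHS]nE itineraryD st// -nE.
  by rewrite [in LHS]nE itineraryD st// -nE.
have prE' b v : (b <= L)%N -> (forall x, word_event b n v x -> phase L b x n.-1 = al) ->
    pr mu (word_event b n v) =
    pr mu (word_event b s v `&` [set x | phase L b x s = L]) *
    pr mu (word_event L k (fun t => v (s + t)%N)).
  move=> bL val; rewrite -[word_event L k _]setIT -pr_word_event_start//.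
    by rewrite preimage_setT setIT -nE.
  exact: start.
have vE : word_event L k (fun t => w (s + t)%N) =
    word_event L k (fun t => w' (s + t)%N).
  by apply/seteqP; split => x xw t tk; rewrite xw//; [|apply/esym];
    apply: ww'; rewrite /s /k in tk *; lia.
rewrite !zE// !prE'// vE; set A1 := pr mu _; set A2 := pr mu _; set A3 := pr mu _.
by set A4 := pr mu _; rewrite mulrACA [RHS]mulrACA [A3 * A1]mulrC.
Qed.

End block_code_law.
End block_coding.

(** * Block codes are finite-order Markov processes *)

Lemma block_eqP i n (x : seqs bool) (w : n.-tuple bool) :
  block i n x = w <-> forall t, (t < n)%N -> x (i + t)%N = nth false w t.
Proof.
split=> [<- t ltn|xw].
  by rewrite -[t in RHS]/(nat_of_ord (Ordinal ltn)) -tnth_nth tnth_mktuple.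
by apply: eq_from_tnth => t; rewrite tnth_mktuple (tnth_nth false) xw.
Qed.

Lemma measurable_block i n (w : n.-tuple bool) :
  measurable [set x : seqs bool | block i n x = w].
Proof.
apply: (@measurable_bool_below (i + n)) => x y xy /= /block_eqP xw.
by apply/block_eqP => t ltn; rewrite -xw// xy// ltn_add2l.
Qed.

Section block_code_markov.
Context (L m : nat) (m_gt0 : (0 < m)%N) (ltmL : (m < L)%N).
Variable psi : nat -> seqs bool -> bool.
Hypothesis psi_rows : forall a x y, same_rows a.-1 x y -> psi a x = psi a y.
Context (R : realType) (mu : process R bool) (fair_mu : fair mu).
Hypothesis mpsi : measurable_letters psi.
Variable Q : process R bool.
Local Notation block_code := (block_code L m psi).
Local Notation word_event := (word_event L m psi).
Hypothesis QE : is_law mu L block_code Q.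

Lemma law_block n (w : n.-tuple bool) :
  pr Q [set x | block 0 n x = w] =
  L.+1%:R^-1 * \sum_(a < L.+1) pr mu (word_event a n (nth false w)).
Proof.
rewrite QE; last exact: measurable_block.
congr (_ * _); apply: eq_bigr => a _; congr (pr mu _).
apply/seteqP; split => x; first by move/block_eqP.
by move=> xw; apply/block_eqP; exact: xw.
Qed.

Lemma law_block_next n (w : n.-tuple bool) c :
  pr Q ([set x | x n = c] `&` [set x | block 0 n x = w]) =
  L.+1%:R^-1 * \sum_(a < L.+1)
    pr mu (word_event a n (nth false w) `&`
      [set x | itinerary L block_code a x n = c]).
Proof.
rewrite QE; last first.
  by apply: measurableI; [exact: measurable_bool_coord|exact: measurable_block].
congr (_ * _); apply: eq_bigr => a _; congr (pr mu _).
apply/seteqP; split => x; first by move=> [? /block_eqP].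
by move=> [xw ?]; split => //; apply/block_eqP; exact: xw.
Qed.

(** Conditioning on the last symbols only is averaging over the older pasts, for
    all of which the next symbol has the same law by [word_event_cross]. *)
Lemma block_code_markov : markov_of_order (L + m.+1) Q.
Proof.
set K := (L + m.+1)%N => n u v c pos.
pose B (u' : n.-tuple bool) :=
  [set x : seqs bool | block 0 (n + K) x = [tuple of u' ++ v]].
pose E := [set x : seqs bool | x (n + K)%N = c].
pose G := [set x : seqs bool | block n K x = v].
have mB u' : measurable (B u') by exact: measurable_block.
have mE : measurable E by exact: measurable_bool_coord.
have mG : measurable G by exact: measurable_block.
have BE u' : G `&` [set x | block 0 n x = u'] = B u'.
  apply/seteqP; split => x /=.
    move=> [/block_eqP xv /block_eqP xu]; apply/block_eqP => t lt.
    rewrite nth_cat size_tuple; case: ltnP => [/xu//|lnt].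
    by rewrite -xv; [rewrite add0n subnKC|lia].
  move=> /block_eqP xw; split; apply/block_eqP => t lt.
    rewrite -[(n + t)%N]add0n xw ?ltn_add2l//.
    by rewrite nth_cat size_tuple ltnNge leq_addr /= addKn.
  by rewrite xw ?(ltn_addr K)// nth_cat size_tuple lt.
have cross u' : pr Q (E `&` B u) * pr Q (B u') = pr Q (E `&` B u') * pr Q (B u).
  rewrite !law_block !law_block_next.
  rewrite mulrACA [RHS]mulrACA; congr (_ * _).
  rewrite !mulr_suml; under eq_bigr do rewrite mulr_sumr.
  under [in RHS]eq_bigr do rewrite mulr_sumr.
  rewrite [RHS]exchange_big; apply: eq_bigr => a _; apply: eq_bigr => a' _.
  apply: word_event_cross => //; try by rewrite -ltnS.
    exact: leq_addl.
  move=> t /andP[nt _]; rewrite !nth_cat !size_tuple ltnNge (_ : (n <= t)%N)//.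
  by move: nt; rewrite /K; lia.
have crossG : pr Q (E `&` B u) * pr Q G = pr Q (E `&` G) * pr Q (B u).
  rewrite (pr_partition Q mG (measurable_block 0 (n := n))).
  rewrite (pr_partition Q (measurableI _ _ mE mG) (measurable_block 0 (n := n))).
  rewrite mulr_sumr mulr_suml; apply: eq_bigr => u' _.
  by rewrite -setIA BE cross.
have Bu0 : 0 < pr Q (B u) by move: pos; rewrite -/(B u) prE// lte_fin.
have G0 : 0 < pr Q G.
  apply: (lt_le_trans Bu0); apply: le_pr => //.
  by rewrite -BE; exact: subIsetl.
have nB : pr Q (B u) != 0 by rewrite gt_eqF.
have nG : pr Q G != 0 by rewrite gt_eqF.
rewrite /cond_prob -/(pr Q _) -/(pr Q (B u)) -/(pr Q (E `&` G)) -/(pr Q G).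
by apply/eqP; rewrite (eqr_div _ _ nB nG); apply/eqP; exact: crossG.
Qed.

End block_code_markov.

(** * Ergodicity and aperiodicity *)

Section approximation.
Context (R : realType) (P : process R bool).

Definition symdiff (E F : set (seqs bool)) := (E `\` F) `|` (F `\` E).

Lemma measurable_symdiff E F :
  measurable E -> measurable F -> measurable (symdiff E F).
Proof. by move=> mE mF; apply: measurableU; exact: measurableD. Qed.

Definition approximable (E : set (seqs bool)) := measurable E /\
  forall e : R, 0 < e ->
    exists n C, depends_below n C /\ pr P (symdiff E C) < e.

(** Finitely many of the events exhaust the union up to [e / 2], and these are
    approximated within [e / 2] altogether. *)
Lemma approximable_bigcup (F : nat -> set (seqs bool)) :
  (forall k, approximable (F k)) -> approximable (\bigcup_k F k).
Proof.
move=> aF; have mF k : measurable (F k) by have [] := aF k.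
have mU : measurable (\bigcup_k F k) by exact: bigcup_measurable.
split=> // e e0.
pose U N := [set x | exists2 k, (k < N)%N & F k x].
have mUN N : measurable (U N).
  rewrite (_ : U N = \bigcup_(k < N) F k); first exact: bigcup_measurable.
  by apply/seteqP; split.
have [N UN] : exists N, pr P ((\bigcup_k F k) `\` U N) < e / 2.
  have cU : (P \o U) @ \oo --> P (\bigcup_N U N).
    apply: nondecreasing_cvg_mu => //; first exact: bigcup_measurable.
    move=> i j ij; apply/subsetPset => x [k ki Fx]; exists k => //.
    exact: leq_trans ij.
  have UE : \bigcup_N U N = \bigcup_k F k.
    apply/seteqP; split => x; first by move=> [N _ [k _ Fk]]; exists k.
    by move=> [k _ Fk]; exists k.+1 => //; exists k.
  rewrite UE in cU.
  have /fine_cvgP[_ /cvgrPdist_lt/(_ (e / 2)) []] :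
      (P \o U) @ \oo --> (pr P (\bigcup_k F k))%:E.
    by rewrite -prE.
    by rewrite divr_gt0.
  move=> N _ /(_ N (leqnn N)) /= h; exists N.
  have sU : U N `<=` \bigcup_k F k by move=> x [k _ Fk]; exists k.
  have := prID P mU (mUN N); rewrite setIidr// setDE => hh.
  apply: le_lt_trans h; rewrite -/(pr P (U N)); apply: le_trans (ler_norm _).
  by rewrite hh addrC addKr lexx.
have /choice[n /choice[C nC]] : forall k, exists n C, depends_below n C /\
    pr P (symdiff (F k) C) < e / (2 * N.+1%:R).
  by move=> k; have [_] := aF k; apply; rewrite divr_gt0// mulr_gt0.
pose D := [set x | exists2 k, (k < N)%N & C k x].
exists (\max_(k < N) n k), D; split.
  move=> x y xy [k kN Ckx]; exists k => //.
  have [+ _] := nC k; apply; last exact: Ckx.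
  by move=> i ik; apply: xy; rewrite (leq_trans ik)// (leq_bigmax (Ordinal kN)).
have mC k : measurable (C k) by have [/measurable_bool_below] := nC k.
have mD : measurable D.
  rewrite (_ : D = \bigcup_(k < N) C k); first exact: bigcup_measurable.
  by apply/seteqP; split.
have mS k : measurable (symdiff (F k) (C k)) by exact: measurable_symdiff.
have mSN : measurable [set x | exists2 k, (k < N)%N & symdiff (F k) (C k) x].
  rewrite (_ : mkset _ = \bigcup_(k < N) symdiff (F k) (C k)).
    exact: bigcup_measurable.
  by apply/seteqP; split.
have sub : symdiff (\bigcup_k F k) D `<=`
    ((\bigcup_k F k) `\` U N) `|`
      [set x | exists2 k, (k < N)%N & symdiff (F k) (C k) x].
  move=> x [[Fx nD]|[[k kN Ck] nF]].
    have [[k kN Fk]|nU] := pselect (U N x); last by left.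
    by right; exists k => //; left; split => // Ck; apply: nD; exists k.
  by right; exists k => //; right; split => // Fk; apply: nF; exists k.
apply: (le_lt_trans (le_pr P _ _ sub)); first exact: measurable_symdiff.
  by apply: measurableU => //; exact: measurableD.
apply: (le_lt_trans (prU_le P _ _)) => //; first exact: measurableD.
have := pr_exists_lt_le (P := P) N (p := e / (2 * N.+1%:R)) mS.
move=> /(_ (fun i => ltW (proj2 (nC i)))) h.
apply: (lt_le_trans (ltr_leD UN h)).
have N0 : 0 < N.+1%:R :> R by rewrite ltr0n.
rewrite [leRHS](splitr e) lerD2l.
rewrite (_ : _ * _ = e / 2 * (N%:R / N.+1%:R)); last by rewrite invfM; ring.
rewrite ler_piMr//; first by rewrite divr_ge0// ltW.
by rewrite ler_pdivrMr// mul1r ler_nat.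
Qed.

Lemma measurable_approximable E : measurable E -> approximable E.
Proof.
move: E; change (@borel bool `<=` approximable).
rewrite (borel_depends_below finite_bool open_bool).
apply: smallest_sub; last first.
  move=> V [n dV]; split; first exact: measurable_bool_below dV.
  by move=> e e0; exists n, V; split => //; rewrite /symdiff setDv setU0 pr_set0.
split.
- split; first exact: measurable0.
  move=> e e0; exists 0%N, set0; split => //.
  by rewrite /symdiff setDv setU0 pr_set0.
- move=> E [mE aE]; rewrite setTD; split; first exact: measurableC.
  move=> e e0; have [n [C [dC CE]]] := aE e e0.
  exists n, (~` C); split.
    by move=> x y xy nC Cy; apply: nC; apply: dC Cy => i /xy.
  rewrite (_ : symdiff _ _ = symdiff E C)//; apply/seteqP; split => x.
    by move=> [[nE /contrapT Cx]|[nC /contrapT Ex]]; [right|left].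
  by move=> [[Ex nC]|[Cx nE]]; [right|left]; split => //; apply.
- exact: approximable_bigcup.
Qed.

(** Cylinders are dense, so the lower bound on them extends to all events, in
    particular to the complement of [E], where it forces probability 0. *)
Lemma zero_one_of_cylinders (E : set (seqs bool)) (d : R) :
  measurable E -> 0 < d ->
  (forall n C, depends_below n C -> d * pr P C <= pr P (E `&` C)) -> pr P E = 1.
Proof.
move=> mE d0 Ed; apply/eqP; rewrite eq_le pr_le1//=.
rewrite leNgt; apply/negP => E1.
have mEC : measurable (~` E) by exact: measurableC.
pose p := pr P (~` E); have p0 : 0 < p by rewrite /p prC// subr_gt0.
(* An event within e of the complement of E has probability at least p - e,
   and meets E with probability at most e < d * (p - e). *)
pose e := d * p / (2 * (1 + d)).
have d10 : 0 < 1 + d by lra.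
have e0 : 0 < e by rewrite divr_gt0 ?mulr_gt0.
have [_ /(_ e e0)[n [C [dC CE]]]] := measurable_approximable mEC.
have mC := measurable_bool_below dC.
have mS := measurable_symdiff mEC mC.
have h1 : pr P (E `&` C) <= e.
  apply/ltW/(le_lt_trans _ CE)/le_pr => //; first exact: measurableI.
  by move=> x [Ex Cx]; right; split => //; apply.
have h2 : p <= pr P C + e.
  apply: (@le_trans _ _ (pr P (C `|` symdiff (~` E) C))).
    apply: le_pr; [by []|exact: measurableU|].
    move=> x nE; have [Cx|nC] := pselect (C x); first by left.
    by right; left.
  by apply: (le_trans (prU_le P mC mS)); rewrite lerD2l ltW.
have := le_trans (Ed _ _ dC) h1 => h3.
have h4 : d * p <= (1 + d) * e.
  apply: (@le_trans _ _ (d * (pr P C + e))); first by rewrite ler_pM2l.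
  by rewrite mulrDr mulrDl mul1r lerD2r.
have h5 : (1 + d) * e = d * p / 2 by rewrite /e; field; rewrite gt_eqF//; lra.
have : 0 < d * p by exact: mulr_gt0.
by lra.
Qed.

End approximation.

Section recurrence.
Context (R : realType) (mu : process R bool) (fair_mu : fair mu).

Lemma coin_word (c : nat -> bool) r :
  let Q := [set x | forall t, (t < r)%N -> coin (drop_rows t x) = c t] in
  [/\ measurable Q, depends_rows r Q & 0 < pr mu Q].
Proof.
elim: r => [|r [mQ dQ Q0]] /=.
  rewrite (_ : mkset _ = setT); first by rewrite pr_setT.
  by apply/seteqP; split.
set Q := mkset _ in mQ dQ Q0.
have QE : [set x | forall t, (t < r.+1)%N -> coin (drop_rows t x) = c t] =
    Q `&` drop_rows r @^-1` [set x | coin x = c r].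
  apply/seteqP; split => x /=.
    by move=> h; split; [move=> t /ltnW; exact: h|exact: h].
  by move=> [h h'] t; rewrite ltnS leq_eqVlt => /orP[/eqP -> //|]; exact: h.
rewrite QE; split.
- apply: measurableI => //; apply: measurable_preimage_drop_rows.
  exact: measurable_coin.
- move=> x y xy [h h']; split; first exact: dQ (same_rows_le (leqnSn r) xy) h.
  have := @same_rows_drop_rows _ r _ _ xy; rewrite subSnn => /(coin_rows (b := c r)).
  by apply.
- rewrite (fair_rows fair_mu)//; last exact: measurable_coin.
  by rewrite pr_coin// mulr_gt0// invr_gt0.
Qed.

(** All coins heads for [L] steps reach phase 0 from anywhere; the one tail that
    follows starts a block, at phase [L]. *)
Lemma phase_synchronised L i r : (i <= L)%N -> (L.*2 < r)%N ->
  exists Q, [/\ measurable Q, depends_rows r Q, 0 < pr mu Q &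
    forall a x, (a <= L)%N -> Q x -> phase L a x r = i].
Proof.
move=> iL Lr.
(* The time of the only tail; the block it starts then counts down to i. *)
pose p := (r.-1 - (L - i))%N.
have [mQ dQ Q0] := coin_word (fun t => t != p) r.
eexists; split; [exact: mQ|exact: dQ|exact: Q0|move=> a x aL xc].
have up t : (t <= p)%N -> (phase L a x t <= L - t)%N.
  elim: t => [|t IH] tp /=; first by rewrite subn0.
  rewrite /step xc; last by rewrite /p in tp; lia.
  by have := IH (ltnW tp); rewrite (_ : (t != p) = true); [case: ifP; lia|lia].
have p0 : phase L a x p = 0%N by have := up p (leqnn p); rewrite /p; lia.
have down j : (j <= L - i)%N -> phase L a x (p.+1 + j) = (L - j)%N.
  elim: j => [|j IH] jL.
    rewrite addn0 subn0 /= p0 /step xc ?eqxx//; rewrite /p; lia.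
  rewrite addnS -[LHS]/(step L (phase L a x (p.+1 + j))
    (coin (drop_rows (p.+1 + j) x))).
  rewrite IH; last exact: ltnW.
  rewrite /step xc; last by rewrite /p; lia.
  by rewrite (_ : (_ != p) = true); [case: ifP; lia|lia].
have := down (L - i)%N (leqnn _).
rewrite (_ : (p.+1 + (L - i))%N = r); last by rewrite /p; lia.
by rewrite subKn.
Qed.

Context (L m : nat) (m_gt0 : (0 < m)%N) (ltmL : (m < L)%N).
Variable psi : nat -> seqs bool -> bool.
Hypothesis psi_rows : forall a x y, same_rows a.-1 x y -> psi a x = psi a y.
Hypothesis mpsi : measurable_letters psi.
Variable Q : process R bool.
Local Notation block_code := (block_code L m psi).
Local Notation word_event := (word_event L m psi).
Hypothesis QE : is_law mu L block_code Q.

Lemma shift_invariant_iter (B : set (seqs bool)) r y :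
  @time_shift bool @^-1` B = B -> B (fun t => y (r + t)%N) <-> B y.
Proof.
move=> BE; elim: r y => [|r IH] y //.
rewrite -(IH y) -[in X in _ <-> X]BE /= /time_shift.
suff -> : (fun t => y (r.+1 + t)%N) = (fun n => y (r + n.+1)%N) by [].
by apply/funext => t; rewrite addnS addSn.
Qed.

Lemma measurable_itinerary_preimage a (B : set (seqs bool)) :
  measurable B -> measurable (itinerary L block_code a @^-1` B).
Proof.
move=> mB; apply: (measurable_fun_preimage _ mB).
by apply: (measurable_itinerary finite_bool open_bool); exact: measurable_block_code.
Qed.

(** Whatever the first [n] coins are, with a positive probability that does not
    depend on them the next ones lead to the start of a block, from where an
    invariant event has the probability of a fresh run. *)
Lemma invariant_event_full (B : set (seqs bool)) a :
  measurable B -> @time_shift bool @^-1` B = B -> (a <= L)%N ->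
  0 < pr mu (itinerary L block_code L @^-1` B) ->
  pr mu (itinerary L block_code a @^-1` B) = 1.
Proof.
move=> mB BE aL BL.
have [S [mS dS S0 SL]] := phase_synchronised (leqnn L) (ltnSn L.*2).
set r := L.*2.+1 in dS SL.
set BB := itinerary L block_code L @^-1` B in BL.
have mBB : measurable BB by exact: measurable_itinerary_preimage.
have mBa := measurable_itinerary_preimage a mB.
apply: (zero_one_of_cylinders mBa (mulr_gt0 S0 BL)) => n C dC.
have mC := measurable_bool_below dC.
have mSB : measurable (S `&` drop_rows r @^-1` BB).
  by apply: measurableI => //; exact: measurable_preimage_drop_rows.
rewrite -(fair_rows fair_mu mS mBB dS) mulrC.
rewrite -(fair_rows fair_mu mC mSB (depends_below_rows dC)).
apply: le_pr; [|exact: measurableI|].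
  by apply: measurableI => //; exact: measurable_preimage_drop_rows.
move=> x [Cx [Sx Bx]]; split => //=.
apply/(shift_invariant_iter (n + r) _ BE).
rewrite (_ : (fun t => _) = itinerary L block_code L (drop_rows r (drop_rows n x)))//.
apply/funext => t; rewrite -addnA.
transitivity (itinerary L block_code a x (n + (r + t))) => //.
rewrite itineraryD itineraryD SL//.
exact: phase_le.
Qed.

Lemma block_code_ergodic : ergodic Q.
Proof.
move=> B mB BE; rewrite !prE//.
have full C : measurable C -> @time_shift bool @^-1` C = C ->
    0 < pr mu (itinerary L block_code L @^-1` C) -> pr Q C = 1.
  move=> mC CE C0; rewrite QE// (eq_bigr (fun=> 1)).
    by rewrite sumr_const card_ord mulVf// pnatr_eq0.
  by move=> a _; apply: invariant_event_full => //; rewrite -ltnS.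
have [B0|B0] := ltP 0 (pr mu (itinerary L block_code L @^-1` B)).
  by right; rewrite full.
have {}B0 : pr mu (itinerary L block_code L @^-1` B) = 0.
  by apply/eqP; rewrite eq_le B0 pr_ge0.
left; have : pr Q (~` B) = 1.
  apply: full; [exact: measurableC|by rewrite -preimage_setC BE|].
  rewrite -preimage_setC prC; last exact: measurable_itinerary_preimage.
  by rewrite B0 subr0 ltr01.
by rewrite prC// => h; congr EFin; lra.
Qed.

(** A word that can be read from phase [a] can be read again after any
    sufficiently long delay, since coins can drive the phase back to [a]; two
    consecutive delays leave 1 as the only common divisor. *)
Lemma block_code_aperiodic k : aperiodic k Q.
Proof.
move=> w w0 d dP.
have mw := measurable_block 0 w.
have [a aL wa] : exists2 a, (a <= L)%N & 0 < pr mu (word_event a k (nth false w)).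
  apply: contrapT => na; move: w0; rewrite prE// lte_fin (law_block QE).
  rewrite big1 ?mulr0 ?ltxx// => a _; apply/eqP; rewrite eq_le pr_ge0 andbT leNgt.
  by apply/negP => a0; apply: na; exists a => //; rewrite -ltnS.
have mW : measurable (word_event a k (nth false w)) by exact: measurable_word_event.
have dW : depends_rows (k + L) (word_event a k (nth false w)).
  exact: word_event_rows.
have ret r : (L.*2 < r)%N -> (d %| k + L + r)%N.
  move=> Lr; have [S [mS dS S0 SL]] := phase_synchronised aL Lr.
  apply: dP; first lia.
  rewrite /cond_prob -/(pr Q _) -/(pr Q [set x | block 0 k x = w]).
  apply: divr_gt0; last by move: w0; rewrite prE// lte_fin.
  set n := (k + L + r)%N.
  pose W := word_event a k (nth false w).
  have mE : measurable ([set x | block n k x = w] `&` [set x | block 0 k x = w]).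
    by apply: measurableI; exact: measurable_block.
  rewrite QE//; apply: mulr_gt0; first by rewrite invr_gt0.
  rewrite (bigD1 (Ordinal (aL : (a < L.+1)%N)))//=.
  apply: ltr_wpDr; first by apply: sumr_ge0 => i _; exact: pr_ge0.
  have mSW : measurable (S `&` drop_rows r @^-1` W).
    by apply: measurableI => //; exact: measurable_preimage_drop_rows.
  apply: (@lt_le_trans _ _
    (pr mu (W `&` drop_rows (k + L) @^-1` (S `&` drop_rows r @^-1` W)))).
    by rewrite !(fair_rows fair_mu)//; rewrite !mulr_gt0.
  apply: le_pr; [|exact: measurable_itinerary_preimage|].
    by apply: measurableI => //; exact: measurable_preimage_drop_rows.
  move=> x [Wx [Sx Wx']]; split; apply/block_eqP => t tk.
    rewrite /n -addnA itineraryD itineraryD SL//; last exact: phase_le.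
    exact: Wx'.
  exact: Wx.
have h1 := ret L.*2.+1 (ltnSn _); have := ret L.*2.+2 (ltnW (ltnSn _)).
by rewrite addnS -addn1 dvdn_addr// dvdn1 => /eqP.
Qed.

End recurrence.

(** * The hierarchy of processes *)

Section hierarchy.
Variable b : nat -> nat.

(** Row 0 of [x], which consists of the even indices, is split further: the
    multiples of 4 hold the bits that determine its height, index 2 holds the
    coin of the phase, and index [4 * j + 6] holds the digit of level [j]. *)
Definition high (k : nat) (x : seqs bool) : bool :=
  [forall i : 'I_(b k), ~~ x i.*2.*2].

Definition digit (j : nat) (x : seqs bool) : bool := x (j.*2.+3).*2.

Definition first_high (k : nat) (x : seqs bool) (t : nat) :=
  (forall s, (s < t)%N -> ~~ high k (drop_rows s x)) /\ high k (drop_rows t x).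

(** The default value 0 only concerns a null set ([pr_never_high]). *)
Definition state (j : nat) (x : seqs bool) : bool :=
  `[< exists t, first_high j.+1 x t /\ digit j (drop_rows t x) >].

Fixpoint layer (k : nat) (s : bool) (x : seqs bool) : bool :=
  if k is k'.+1 then (if high k x then s else layer k' (state k' x) x) else s.

(** The height of row 0 is the unique [j] in this formula. *)
Definition limit (x : seqs bool) : bool :=
  `[< exists j, [/\ high j x, ~~ high j.+1 x & state j x] >].

Lemma first_high_uniq k x t t' : first_high k x t -> first_high k x t' -> t = t'.
Proof.
move=> [lt ht] [lt' ht']; case: (ltngtP t t') => // [/lt'|/lt].
  by rewrite ht.
by rewrite ht'.
Qed.

Lemma state_first k x t : first_high k.+1 x t -> state k x = digit k (drop_rows t x).
Proof.
move=> ft; apply/asboolP/idP => [[t' [ft' dt']]|dt]; last by exists t.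
by rewrite (first_high_uniq ft ft').
Qed.

Lemma first_high_exists k x t : high k (drop_rows t x) ->
  exists2 t', (t' <= t)%N & first_high k x t'.
Proof.
move=> ht; have ex : exists t, high k (drop_rows t x) by exists t.
exists (ex_minn ex); first by case: ex_minnP => t' _; exact.
case: ex_minnP => t' ht' lt'; split => // s st'; apply/negP => /lt'.
by rewrite leqNgt st'.
Qed.

Lemma layer_high k s x : high k x -> layer k s x = s.
Proof. by case: k => //= k ->. Qed.

Lemma high_rows0 k n x y : same_rows n.+1 x y -> high k x = high k y.
Proof.
by move=> xy; apply: eq_forallb => i; rewrite (same_rows_row0 _ xy).
Qed.

Lemma high_rows k n t x y : same_rows n x y -> (t < n)%N ->
  high k (drop_rows t x) = high k (drop_rows t y).
Proof.
move=> xy tn; have := @same_rows_drop_rows _ t _ _ xy.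
by rewrite (_ : n - t = (n - t).-1.+1)%N; [exact: high_rows0|lia].
Qed.

(** Flipping one column of digits in every row flips one state, keeping the
    heights and all the other states. *)
Definition column (k : nat) : seqs bool :=
  fun i => ((i.+1)`_2^' == (k.*2.+3).*2.+1)%N.

Lemma column_drop_rows k t x :
  drop_rows t (flip (column k) x) = flip (column k) (drop_rows t x).
Proof.
apply/funext => i; rewrite /drop_rows /reindex /flip; congr (_ (+) _).
rewrite /column row_indexS.
by rewrite partnM ?expn_gt0// partnX (@part_p'nat (negn 2%N) 2%N) ?exp1n ?mul1n//.
Qed.

Lemma column_even k i : column k i.*2 = (i == k.*2.+3).
Proof.
rewrite /column part_pnat_id; last by rewrite p'natE// dvdn2 /= odd_double.
by rewrite eqSS (inj_eq double_inj).
Qed.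

Lemma high_column k j x : high j (flip (column k) x) = high j x.
Proof.
apply: eq_forallb => i; rewrite /flip column_even.
by rewrite (_ : (_ == _) = false) ?addbF//; lia.
Qed.

Lemma digit_column k j x : digit j (flip (column k) x) = digit j x (+) (j == k).
Proof.
by rewrite /digit /flip column_even !eqSS (inj_eq double_inj).
Qed.

Lemma first_high_column k j x t :
  first_high j (flip (column k) x) t <-> first_high j x t.
Proof.
rewrite /first_high column_drop_rows high_column.
by split=> -[H ?]; split => // s /H; rewrite column_drop_rows high_column.
Qed.

Lemma state_column_neq k j x : j != k -> state j (flip (column k) x) = state j x.
Proof.
move=> jk; apply: asbool_equiv_eq; split => -[t [ft dt]]; exists t; split.
- by move/first_high_column: ft.
- by move: dt; rewrite column_drop_rows digit_column (negbTE jk) addbF.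
- exact/first_high_column.
- by rewrite column_drop_rows digit_column (negbTE jk) addbF.
Qed.

(** The row in which the state is stored is not moved by the flip. *)
Lemma state_column k x t : first_high k.+1 x t ->
  state k (flip (column k) x) = ~~ state k x.
Proof.
move=> ft; rewrite (state_first ft) (@state_first _ _ t); last exact/first_high_column.
by rewrite column_drop_rows digit_column eqxx addbT.
Qed.

Lemma layer_column k j s x : (j <= k)%N -> layer j s (flip (column k) x) = layer j s x.
Proof.
elim: j s => //= j IH s jk; rewrite high_column state_column_neq ?ltn_eqF//.
by rewrite IH// ltnW.
Qed.

Hypothesis b0 : b 0%N = 0%N.
Hypothesis b_incr : forall k, (b k < b k.+1)%N.

Lemma high0 x : high 0 x.
Proof. by apply/forallP => -[i]; rewrite b0. Qed.

Lemma b_le j k : (j <= k)%N -> (b j <= b k)%N.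
Proof.
move=> jk; rewrite -(subnKC jk); elim: (k - j)%N => [|n IH]; first by rewrite addn0.
by rewrite addnS (leq_trans IH)// ltnW.
Qed.

Lemma b_ge k : (k <= b k)%N.
Proof. by elim: k => // k IH; exact: leq_ltn_trans IH (b_incr k). Qed.

Lemma high_le j k x : (j <= k)%N -> high k x -> high j x.
Proof.
move=> jk /forallP hk; apply/forallP => i.
exact: (hk (widen_ord (b_le jk) i)).
Qed.

Lemma state_rows k j n t x y : same_rows n x y -> (t < n)%N ->
  high k (drop_rows t x) -> (j < k)%N -> state j x = state j y.
Proof.
move=> xy tn ht jk.
have [t' t't [lt' ht']] := first_high_exists (high_le jk ht).
have t'n : (t' < n)%N by exact: leq_ltn_trans tn.
have fy : first_high j.+1 y t'.
  split=> [s st'|]; last by rewrite -(high_rows _ xy).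
  by rewrite -(high_rows _ xy) ?lt'//; exact: ltn_trans t'n.
rewrite (state_first fy) (state_first (conj lt' ht')) /digit.
have := @same_rows_drop_rows _ t' _ _ xy.
by rewrite (_ : n - t' = (n - t').-1.+1)%N; [move/same_rows_row0|lia].
Qed.

(** The output at time 0 is settled by the rows up to the first one of height
    at least [k], because all states below [k] are renewed there. *)
Lemma layer_rows k s n t x y : same_rows n x y -> (t < n)%N ->
  high k (drop_rows t x) -> layer k s x = layer k s y.
Proof.
move=> xy tn ht; have : (k <= k)%N by []; move: {1 3 4}k s => j s.
elim: j s => //= j IH s jk.
have -> : high j.+1 x = high j.+1 y.
  by apply: (@high_rows0 _ n.-1); rewrite prednK//; exact: leq_trans tn.
case: ifP => // _; rewrite (state_rows xy tn ht jk).
by apply: IH; exact: ltnW.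
Qed.

Lemma layer_succ k s x : ~~ high k.+1 x -> layer k.+1 s x = layer k (state k x) x.
Proof. by move=> /= /negbTE ->. Qed.

Lemma limit_layer k s x : ~~ high k x -> limit x = layer k s x.
Proof.
elim: k s => [|k IH] s hk; first by rewrite high0 in hk.
rewrite layer_succ//; have [hk'|] := boolP (high k x); last exact: IH.
rewrite layer_high//; apply/asboolP/idP => [[j [hj hj' sj]]|sk]; last by exists k.
suff <- : j = k by [].
case: (ltngtP j k) => // lt; first by move: hj'; rewrite (high_le lt hk').
by move: hk; rewrite (high_le lt hj).
Qed.

Section laws.
Context (R : realType) (mu : process R bool) (fair_mu : fair mu).

Lemma measurable_high k : measurable [set x | high k x].
Proof.
apply: (@measurable_bool_below (b k).*2.*2) => x y xy /= /forallP h.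
apply/forallP => i; rewrite -xy//.
by rewrite !ltn_double.
Qed.

Lemma pr_high k : pr mu [set x | high k x] = 2^-1 ^+ b k.
Proof.
have zeros n :
    pr mu [set x : seqs bool | forall i, (i < n)%N -> x i = false] = 2^-1 ^+ n.
  elim: n => [|n IH].
    by rewrite (_ : mkset _ = setT) ?pr_setT//; apply/seteqP; split.
  rewrite exprSr -IH -(@fair_mu n _ false); last first.
    by move=> x y xy h i ltin; rewrite -xy// h.
  congr (pr mu _); apply/seteqP; split => x /=.
    by move=> h; split => [i ltin|]; apply: h => //; exact: ltnW.
  by move=> [h xn] i; rewrite ltnS leq_eqVlt => /orP[/eqP -> //|/h].
pose Z := [set x : seqs bool | forall i, (i < b k)%N -> x i = false].
rewrite -zeros -/Z.
have mZ : measurable Z.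
  by apply: (@measurable_bool_below (b k)) => x y xy h i ltin; rewrite -xy// h.
rewrite -[RHS]mul1r -(pr_setT mu) -(fair_indep fair_mu (f := fun i => i.*2.*2))//.
  rewrite setTI; congr (pr mu _); apply/seteqP; split => x /=.
    by move=> /forallP h i ltin; have := h (Ordinal ltin); exact: negbTE.
  by move=> h; apply/forallP => i; rewrite [x _]h.
by move=> i j /double_inj/double_inj.
Qed.

Lemma no_high k n :
  let V := [set x | forall t, (t < n)%N -> ~~ high k (drop_rows t x)] in
  [/\ measurable V, depends_rows n V & pr mu V = (1 - 2^-1 ^+ b k) ^+ n].
Proof.
elim: n => [|n [mQ dQ Q0]] /=.
  rewrite (_ : mkset _ = setT); first by rewrite pr_setT.
  by apply/seteqP; split.
set Q := mkset _ in mQ dQ Q0.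
have mh : measurable (~` [set x | high k x]).
  by apply: measurableC; exact: measurable_high.
have QE : [set x | forall t, (t < n.+1)%N -> ~~ high k (drop_rows t x)] =
    Q `&` drop_rows n @^-1` (~` [set x | high k x]).
  apply/seteqP; split => x /=.
    by move=> h; split; [move=> t /ltnW; exact: h|apply/negP; exact: h].
  by move=> [h /negP h'] t; rewrite ltnS leq_eqVlt => /orP[/eqP -> //|]; exact: h.
rewrite QE; split.
- by apply: measurableI => //; exact: measurable_preimage_drop_rows.
- move=> x y xy [h h']; split; first exact: dQ (same_rows_le (leqnSn n) xy) h.
  by move: h'; rewrite /= (high_rows k xy (ltnSn n)).
- rewrite (fair_rows fair_mu)//.
  by rewrite prC ?pr_high ?Q0 -?exprSr//; exact: measurable_high.
Qed.

Lemma measurable_never_high k :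
  measurable [set x | forall t, ~~ high k (drop_rows t x)].
Proof.
rewrite (_ : mkset _ = \bigcap_t (drop_rows t @^-1` (~` [set x | high k x]))).
  apply: bigcap_measurableType => t _; apply: measurable_preimage_drop_rows.
  by apply: measurableC; exact: measurable_high.
apply/seteqP; split => x /= h t; first by move=> _; apply/negP; exact: h.
by apply/negP; exact: h.
Qed.

Lemma pr_never_high k : pr mu [set x | forall t, ~~ high k (drop_rows t x)] = 0.
Proof.
set q := 1 - 2^-1 ^+ b k : R.
have half0 : 0 < 2^-1 ^+ b k :> R by rewrite exprn_gt0 ?invr_gt0.
have half1 : 2^-1 ^+ b k <= 1 :> R.
  by rewrite exprn_ile1 ?invr_ge0// invf_le1// ler1n.
have q1 : `|q| < 1 by rewrite /q ger0_norm; lra.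
apply/eqP; rewrite eq_le pr_ge0 andbT leNgt; apply/negP => p0.
have /cvgrPdist_lt/(_ _ p0)[n _ /(_ n (leqnn n))] := cvg_expr q1.
rewrite /= sub0r normrN normrX ger0_norm; last by rewrite /q; lra.
rewrite ltNge => /negP; apply.
have [mV _ <-] := no_high k n; apply: le_pr => //; first exact: measurable_never_high.
by move=> x /= h t _.
Qed.

Lemma measurable_first_high k t : measurable [set x | first_high k x t].
Proof.
have [mV _ _] := no_high k t.
rewrite (_ : mkset _ = [set x | forall s, (s < t)%N -> ~~ high k (drop_rows s x)] `&`
    drop_rows t @^-1` [set x | high k x]).
  apply: measurableI => //; apply: measurable_preimage_drop_rows.
  exact: measurable_high.
by apply/seteqP; split.
Qed.

Lemma measurable_bool_eq (f : seqs bool -> bool) c :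
  measurable [set x | f x] -> measurable [set x | f x = c].
Proof.
move=> mf; case: c => //.
rewrite (_ : mkset _ = ~` [set x | f x]); first exact: measurableC.
by apply/seteqP; split => x /=; case: (f x).
Qed.

Lemma measurable_state j : measurable [set x | state j x].
Proof.
rewrite (_ : mkset _ = \bigcup_t ([set x | first_high j.+1 x t] `&`
    drop_rows t @^-1` [set x | digit j x])).
  apply: bigcup_measurable => t _; apply: measurableI; first exact: measurable_first_high.
  by apply: measurable_preimage_drop_rows; exact: measurable_bool_coord.
apply/seteqP; split => x /=; first by move/asboolP => [t []]; exists t.
by move=> [t _ [? ?]]; apply/asboolP; exists t.
Qed.

Lemma measurable_layer k s : measurable [set x | layer k s x].
Proof.
elim: k s => [|k IH] s /=.
  exact: measurable_const.
rewrite (_ : mkset _ = ([set x | high k.+1 x] `&` [set _ | s]) `|`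
  (~` [set x | high k.+1 x] `&` (([set x | state k x] `&` [set x | layer k true x]) `|`
   (~` [set x | state k x] `&` [set x | layer k false x])))).
  have mh := measurable_high k.+1; have ms := measurable_state k.
  have mhC := measurableC mh; have msC := measurableC ms.
  apply: measurableU.
    by apply: measurableI; [exact: mh|exact: measurable_const].
  apply: measurableI; first exact: mhC.
  apply: measurableU; first by apply: measurableI; [exact: ms|exact: IH].
  by apply: measurableI; [exact: msC|exact: IH].
apply/seteqP; split => x /=.
  case: ifP => [hx sx|/negbT/negP nh]; first by left; split.
  by move=> sx; right; split=> //; move: sx; case: (state k x); [left|right].
move=> [[-> //]|[/negP/negbTE -> ]].
by case=> [[-> ]|[/negP/negbTE ->]].
Qed.

Lemma measurable_limit : measurable [set x | limit x].
Proof.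
rewrite (_ : mkset _ = \bigcup_j ([set x | high j x] `&` ~` [set x | high j.+1 x] `&`
    [set x | state j x])).
  apply: bigcup_measurable => j _; apply: measurableI; last exact: measurable_state.
  apply: measurableI; first exact: measurable_high.
  by apply: measurableC; exact: measurable_high.
apply/seteqP; split => x /=.
  by move/asboolP => [j [? /negP ? ?]]; exists j.
by move=> [j _ [[? /negP ?] ?]]; apply/asboolP; exists j.
Qed.

End laws.

End hierarchy.

(** * The processes of the hierarchy are B-processes *)

Lemma sum_dvdn_sub m : (0 < m)%N ->
  (\sum_(a < (m * m).+1) (m %| m * m - a) = m.+1)%N.
Proof.
move=> m0; rewrite (reindex_inj rev_ord_inj) /=.
rewrite (eq_bigr (fun a : 'I_(m * m).+1 => (m %| a) : nat)); last first.
  by move=> a _; rewrite subSS subKn// -ltnS.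
rewrite -(big_mkord xpredT (fun a => (m %| a) : nat)) big_ltn// dvdn0.
by rewrite -divn_count_dvd mulnK.
Qed.

Lemma sum_leq_ord m n : (m <= n)%N -> (\sum_(a < n.+1) (a <= m) = m.+1)%N.
Proof.
move=> mn; rewrite -(big_mkord xpredT (fun a => (a <= m) : nat)).
rewrite (big_cat_nat (n := m.+1))//= [X in (_ + X)%N]big_nat_cond.
rewrite [X in (_ + X)%N]big1 ?addn0; last first.
  by move=> a /andP[/andP[ma _] _]; rewrite leqNgt ma.
rewrite big_nat_cond (eq_bigr (fun=> 1%N)); last first.
  by move=> a /andP[/andP[_]]; rewrite ltnS => ->.
by rewrite -big_nat_cond sum_nat_const_nat muln1 subn0.
Qed.

Lemma sum_geometric_le (R : realType) (c : R) n : 0 < c <= 1 ->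
  \sum_(a < n.+1) (1 - c) ^+ a.-1 <= 1 + c^-1.
Proof.
move=> /andP[c0 c1].
have geo l : c * \sum_(a < l) (1 - c) ^+ a = 1 - (1 - c) ^+ l.
  elim: l => [|l IH]; first by rewrite big_ord0 mulr0 expr0 subrr.
  by rewrite big_ord_recr /= mulrDr IH exprS; ring.
rewrite big_ord_recl /= expr0 lerD2l -(ler_pM2l c0) mulfV ?gt_eqF//.
rewrite (eq_bigr (fun a : 'I_n => (1 - c) ^+ a))// geo.
by rewrite lerBlDr lerDl exprn_ge0// subr_ge0.
Qed.

Section B_process.
Variable b : nat -> nat.
Hypothesis b0 : b 0%N = 0%N.
Hypothesis b_incr : forall k, (b k < b k.+1)%N.
Context (R : realType) (mu : process R bool) (fair_mu : fair mu).

Definition truncated_layer (k : nat) (s : bool) (a : nat) (x : seqs bool) : bool :=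
  [exists t : 'I_a.-1, high b k (drop_rows t x)] && layer b k s x.

(** A row of height at least [k] among the first [a.-1] ones settles the output
    ([layer_rows]), and otherwise the value is constant. *)
Lemma truncated_layer_rows k s a x y :
  same_rows a.-1 x y -> truncated_layer k s a x = truncated_layer k s a y.
Proof.
move=> xy; rewrite /truncated_layer.
have e : [exists t : 'I_a.-1, high b k (drop_rows t x)] =
         [exists t : 'I_a.-1, high b k (drop_rows t y)].
  by apply: eq_existsb => t; exact: (high_rows b k xy (ltn_ord t)).
rewrite -e; case: existsP => // -[t ht] /=.
exact: (layer_rows b0 b_incr s xy (ltn_ord t) ht).
Qed.

Lemma truncated_layer_neq k s a x : layer b k s x <> truncated_layer k s a x ->
  forall t, (t < a.-1)%N -> ~~ high b k (drop_rows t x).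
Proof.
move=> neq t ta; apply/negP => ht; apply: neq; rewrite /truncated_layer.
by rewrite (_ : [exists _, _] = true)//; apply/existsP; exists (Ordinal ta).
Qed.

Lemma measurable_truncated_layer k s : measurable_letters (truncated_layer k s).
Proof.
move=> a c; apply: measurable_bool_eq.
rewrite (_ : mkset _ =
    ~` [set x | forall t, (t < a.-1)%N -> ~~ high b k (drop_rows t x)] `&`
  [set x | layer b k s x]).
  apply: measurableI; last exact: (measurable_layer b fair_mu).
  by apply: measurableC; have [] := no_high b fair_mu k a.-1.
apply/seteqP; split => x /=.
  move=> /andP[/existsP[t ht] ->]; split => // h.
  by have := h t (ltn_ord t); rewrite ht.
move=> [nh lx]; rewrite /truncated_layer lx andbT.
apply: contrapT => /negP /existsPn h.
by apply: nh => t ta; exact: (h (Ordinal ta)).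
Qed.

Variables (g : seqs bool -> bool) (P : process R bool).
Hypothesis mg : measurable [set x | g x].
Hypothesis PE : is_law mu 0 (fun=> g) P.

Lemma measurable_neq (f h : seqs bool -> bool) :
  measurable [set x | f x] -> measurable [set x | h x] ->
  measurable [set x | f x <> h x].
Proof.
move=> mf mh; rewrite (_ : mkset _ = symdiff [set x | f x] [set x | h x]).
  exact: measurable_symdiff.
apply/seteqP; split => x /=; rewrite /symdiff /=.
  by case: (f x) (h x) => [] [] //= _; [left|right].
by case: (f x) (h x) => [] [] [] [].
Qed.

(** The three error terms: the closing and idle symbols, the periodic 0s, and
    the outputs not settled within the block. *)
Lemma pr_block_code_neq k s m a : 
  pr mu [set x | g x <> block_code (m * m) m (truncated_layer k s) a x] <=
  pr mu [set x | g x <> layer b k s x] + (a <= m)%:R + (m %| m * m - a)%:R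
    + (1 - 2^-1 ^+ b k) ^+ a.-1.
Proof.
set c := 2^-1 ^+ b k : R.
have c0 : 0 < c by rewrite exprn_gt0 ?invr_gt0.
have c1 : c <= 1 by rewrite exprn_ile1 ?invr_ge0// invf_le1// ler1n.
set p := pr mu [set x | g x <> layer b k s x].
have p0 : 0 <= p by exact: pr_ge0.
have q0 : 0 <= (1 - c) ^+ a.-1 by rewrite exprn_ge0// subr_ge0.
have mcode := measurable_block_code (m * m) m (measurable_truncated_layer k s).
have mneq : measurable
    [set x | g x <> block_code (m * m) m (truncated_layer k s) a x].
  by apply: measurable_neq => //; exact: (mcode a true).
have le1 := pr_le1 mu mneq.
have [am|ma] := leqP a m.
  by apply: (le_trans le1); rewrite /= mulr1n; move: (ler0n R (m %| m * m - a)%N); lra.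
have [dm|dm] := boolP (m %| m * m - a)%N.
  by apply: (le_trans le1); rewrite /= mulr1n mulr0n; lra.
rewrite /= !mulr0n !addr0.
have [mV _ <-] := no_high b fair_mu k a.-1; set V := mkset _ in mV *.
have mgl : measurable [set x | g x <> layer b k s x].
  by apply: measurable_neq => //; exact: (measurable_layer b fair_mu).
apply: le_trans (prU_le mu mgl mV).
apply: le_pr => //; first exact: measurableU.
move=> x /=; rewrite /block_code leqNgt ma /= (negbTE dm) => gx.
have [e|ne] := pselect (g x = layer b k s x); last by left.
by right; apply: (@truncated_layer_neq k s a x); rewrite -e.
Qed.

(** Blocks of length [m * m] with period [m]: the average over the phases of the
    errors in [pr_block_code_neq] is of order [1 / m]. *)
Lemma B_process_of_layers :
  (forall e : R, 0 < e -> exists k s, pr mu [set x | g x <> layer b k s x] < e) ->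
  B_process P.
Proof.
move=> gk; split.
  apply: (law_stationary fair_mu finite_bool open_bool _ PE).
  by move=> _ c; exact: measurable_bool_eq.
move=> e e0; have e20 : 0 < e / 2 by rewrite divr_gt0.
have [k [s ks]] := gk _ e20.
set c := 2^-1 ^+ b k : R.
have c0 : 0 < c by rewrite exprn_gt0 ?invr_gt0.
have c1 : c <= 1 by rewrite exprn_ile1 ?invr_ge0// invf_le1// ler1n.
(* Summed over the phases, the coding errors are at most
   2 * m + 3 + c^-1 <= (5 + c^-1) * m. *)
have [m mP] : exists m : nat, (1 < m)%N /\ (5 + c^-1) * 2 / e <= m%:R.
  pose m := (Num.truncn ((5 + c^-1) * 2 / e)).+2.
  exists m; split => //; apply/ltW/(lt_le_trans (truncnS_gt _)).
  by rewrite ler_nat /m.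
have [m1 me] := mP; have m0 : (0 < m)%N by exact: ltnW.
pose L := (m * m)%N.
have ltmL : (m < L)%N by rewrite /L -{1}[m]muln1 ltn_pmul2l.
have psi_rows := @truncated_layer_rows k s.
have mpsi := @measurable_truncated_layer k s.
have mcode := measurable_block_code L m mpsi.
have [Q QE] := law_exists mu finite_bool open_bool L mcode.
exists Q; split.
  exists (L + m.+1)%N; split; first by rewrite addnS.
  - exact: (law_stationary fair_mu finite_bool open_bool mcode QE).
  - exact: (block_code_ergodic fair_mu mpsi QE).
  - exact: (block_code_markov m0 ltmL psi_rows fair_mu mpsi QE).
  - exact: (block_code_aperiodic fair_mu m0 ltmL psi_rows mpsi QE).
have mgl : measurable_letters (fun=> g) by move=> _ c'; exact: measurable_bool_eq.
set p := pr mu _ in ks.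
apply: (@le_lt_trans _ _ (p + (2 * m%:R + 3 + c^-1) / L.+1%:R)%:E).
  apply: (law_dbar_le fair_mu mgl mcode (law_phase_free L PE) QE).
  rewrite -(ler_pM2l (_ : 0 < L.+1%:R)) ?ltr0n// mulrA mulfV ?pnatr_eq0// mul1r.
  apply: (@le_trans _ _ (\sum_(a < L.+1)
      (p + (a <= m)%:R + (m %| L - a)%:R + (1 - c) ^+ a.-1))).
    by apply: ler_sum => a _; exact: pr_block_code_neq.
  rewrite !big_split /= sumr_const card_ord -/p -[p *+ _]mulr_natl.
  rewrite -!natr_sum sum_dvdn_sub// sum_leq_ord; last exact: ltnW.
  rewrite mulrDr -!addrA lerD2l mulrCA mulfV ?pnatr_eq0// mulr1.
  have := @sum_geometric_le R c L; rewrite c0 c1 => /(_ isT) h.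
  by rewrite -!natr1; move: h; rewrite -/c; set S := \sum_(_ < _) _; lra.
rewrite lte_fin [ltRHS](splitr e) ltr_leD//.
rewrite ler_pdivrMr ?ltr0n// -[L.+1%:R]natr1 /L natrM.
have M1 : 1 <= m%:R :> R by rewrite ler1n.
move: me; rewrite ler_pdivrMr// => me.
have V0 : 0 < c^-1 by rewrite invr_gt0.
have h1 : c^-1 <= m%:R * c^-1 by rewrite ler_peMl// ltW.
have h2 : m%:R * ((5 + c^-1) * 2) <= m%:R * (m%:R * e).
  by rewrite ler_wpM2l// ler0n.
move: h1 h2; set M := m%:R in M1 *; set V := c^-1; set MV := M * V.
rewrite (_ : M * ((5 + V) * 2) = 10 * M + 2 * MV); last by rewrite /MV; ring.
rewrite (_ : M * (M * e) = e * (M * M)); last by ring.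
rewrite (_ : e / 2 * (M * M + 1) = (e * (M * M)) / 2 + e / 2); last by ring.
by lra.
Qed.

End B_process.

(** * Expected answers *)

Definition mean_answer (R : realType) (D : discrimination_procedure) n
    (p q : n.-tuple bool -> R) : R :=
  \sum_(w : n.-tuple bool) \sum_(w' : n.-tuple bool) (D n w w')%:R * (p w * q w').

Lemma expected_answerE (R : realType) (D : discrimination_procedure)
    (P Q : process R bool) n :
  expected_answer D P Q n =
  (mean_answer D (fun w : n.-tuple bool => pr P [set x | block 0 n x = w])
               (fun w : n.-tuple bool => pr Q [set x | block 0 n x = w]))%:E.
Proof.
pose S := [set w : seqs bool * seqs bool | D n (block 0 n w.1) (block 0 n w.2)].
pose f (w : seqs bool * seqs bool) :=
  (block 0 n w.1 : n.-tuple bool, block 0 n w.2 : n.-tuple bool).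
have fE (u v : n.-tuple bool) : [set w | f w = (u, v)] =
    [set x | block 0 n x = u] `*` [set x | block 0 n x = v].
  by apply/seteqP; split => -[x y]; rewrite /f /= => -[<- <-].
have mf i : measurable [set w | f w = i].
  by case: i => u v; rewrite fE; apply: measurableX; exact: measurable_block.
have mS : measurable S.
  rewrite (_ : S =
    \bigcup_(i in [set i : n.-tuple bool * n.-tuple bool | D n i.1 i.2])
    [set w | f w = i]).
    by apply: fin_bigcup_measurable => //; exact: finite_finset.
  apply/seteqP; split => [w Dw|w [[u v] /= Duv [wu wv]]]; first by exists (f w).
  by rewrite /S /= wu wv.
rewrite /expected_answer unlock.
rewrite (_ : (fun w => _) = (fun w => (\1_S w)%:E)); last first.
  apply/funext => w; rewrite indicE; congr ((nat_of_bool _)%:R)%:E.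
  by apply/idP/idP => [Dw|/set_mem//]; apply/mem_set.
rewrite integral_indic// setIT; apply: (etrans (prE (P \x Q)%E mS)); congr EFin.
rewrite (pr_partition (P \x Q)%E mS mf) /mean_answer pair_big /=.
apply: eq_bigr => -[u v] _ /=.
case: (boolP (D n u v)) => [Duv|nD]; last first.
  rewrite mul0r (_ : _ `&` _ = set0) ?pr_set0//.
  apply/seteqP; split => // w [Dw [wu wv]].
  by move: nD; rewrite -wu -wv; move/negP; apply.
rewrite mul1r (_ : _ `&` _ = [set w | f w = (u, v)]); last first.
  apply/setIidPr => w [wu wv]; by rewrite /S /= wu wv.
have mu' : measurable [set x : seqs bool | block 0 n x = u].
  exact: measurable_block.
have mv : measurable [set x : seqs bool | block 0 n x = v].
  exact: measurable_block.
apply: EFin_inj; rewrite EFinM -(prE P mu') -(prE Q mv) fE.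
rewrite -(product_measure1E P Q mu' mv); apply/esym/prE.
exact: measurableX.
Qed.

(** * The limit process looks like two different processes *)

Definition window (g : seqs bool -> bool) (n : nat) (x : seqs bool) : n.-tuple bool :=
  block 0 n (fun t => g (drop_rows t x) : bool).

Lemma measurable_window (g : seqs bool -> bool) n (w : n.-tuple bool) :
  measurable [set x | g x] -> measurable [set x | window g n x = w].
Proof.
move=> mg; have mgl : measurable_letters (fun=> g).
  by move=> _ c; exact: measurable_bool_eq.
exact: (measurable_fun_preimage (measurable_itinerary finite_bool open_bool 0 0 mgl)
  (measurable_block 0 w)).
Qed.

Definition window_prob (R : realType) (mu : process R bool) (g : seqs bool -> bool)
    n (w : n.-tuple bool) : R :=
  pr mu [set x | window g n x = w].

Lemma pr_law_window (R : realType) (mu : process R bool) (g : seqs bool -> bool)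
    (P : process R bool) n (w : n.-tuple bool) :
  is_law mu 0 (fun=> g) P ->
  pr P [set x | block 0 n x = w] = window_prob mu g w.
Proof.
by move=> PE; rewrite PE ?big_ord1 ?invr1 ?mul1r//; exact: measurable_block.
Qed.

Section mixture.
Variable b : nat -> nat.
Hypothesis b0 : b 0%N = 0%N.
Hypothesis b_incr : forall k, (b k < b k.+1)%N.
Context (R : realType) (mu : process R bool) (fair_mu : fair mu).
Variables (k n : nat).

(** The first conjunct holds almost surely; it excludes the sequences whose state
    is a default value, which a flip does not change. *)
Definition settled (s : bool) : set (seqs bool) :=
  [set x | (exists t, first_high b k.+1 x t) /\ state b k x = s].

Definition calm : set (seqs bool) :=
  [set x | forall t, (t < n)%N -> ~~ high b k.+1 (drop_rows t x)].

Lemma measurable_settled s : measurable (settled s).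
Proof.
rewrite (_ : settled s = (\bigcup_t [set x | first_high b k.+1 x t]) `&`
    [set x | state b k x = s]).
  apply: measurableI.
    by apply: bigcup_measurable => t _; exact: (measurable_first_high b fair_mu).
  by apply: measurable_bool_eq; exact: (measurable_state b fair_mu).
by apply/seteqP; split => x [] => [[t ft] sx|[t _ ft] sx]; split => //; exists t.
Qed.

Lemma measurable_calm : measurable calm.
Proof. by have [] := no_high b fair_mu k.+1 n. Qed.

Lemma window_column g x : (forall x, g (flip (column k) x) = g x) ->
  window g n (flip (column k) x) = window g n x.
Proof.
by move=> gc; apply: eq_from_tnth => i; rewrite !tnth_mktuple column_drop_rows gc.
Qed.

(** Flipping the column of [k] exchanges the two values of the state and keeps
    the window, so the state is a fair bit independent of the window. *)
Lemma pr_settled_window s s' (w : n.-tuple bool) :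
  pr mu (settled s `&` [set x | window (layer b k s') n x = w]) =
  pr mu [set x | window (layer b k s') n x = w] / 2.
Proof.
have mS := measurable_settled.
set W := mkset _; have mW : measurable W.
  by apply: measurable_window; exact: (measurable_layer b fair_mu).
have mSW c : measurable (settled c `&` W) by exact: measurableI.
have eq_s : pr mu (settled (~~ s) `&` W) = pr mu (settled s `&` W).
  rewrite -(fair_flip fair_mu (column k) (mSW s)); congr (pr mu _).
  have WE x : W (flip (column k) x) <-> W x.
    by rewrite /W /= window_column// => y; rewrite layer_column.
  apply/seteqP; split => x /=.
    move=> [[[t ft] sx] Wx]; split; last exact/WE.
    split; first by exists t; exact/first_high_column.
    by rewrite (state_column ft) sx negbK.
  move=> [[[t /first_high_column ft] sx] /WE Wx]; split => //; split; first by exists t.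
  by rewrite -sx (state_column ft) negbK.
have mU : measurable ((settled s `&` W) `|` (settled (~~ s) `&` W)).
  exact: measurableU.
have dU : (settled s `&` W) `&` (settled (~~ s) `&` W) = set0.
  apply/seteqP; split => // x [[[_ e1] _] [[_ e2] _]].
  by move: e2; rewrite e1; case: (s).
have mN := measurable_never_high b k.+1.
have : pr mu W = pr mu (settled s `&` W) + pr mu (settled (~~ s) `&` W).
  apply/eqP; rewrite -prU// eq_le; apply/andP; split; last first.
    by apply: le_pr => // x [[]|[]].
  rewrite -[leRHS]addr0 -(pr_never_high b fair_mu k.+1).
  apply: le_trans (prU_le mu mU mN); apply: le_pr => //; first exact: measurableU.
  move=> x Wx; have [[t ft]|nt] := pselect (exists t, first_high b k.+1 x t).
    left; have [sx|/eqP sx] := eqVneq (state b k x) s.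
      by left; do 2?split => //; exists t.
    right; split => //; split; first by exists t.
    by move: sx; case: (state b k x) (s) => [] [].
  right => t; apply/negP => /first_high_exists[t' _ ft]; apply: nt; by exists t'.
by rewrite eq_s => e; lra.
Qed.

(** In a calm window no row renews the state of level [k], and none has an output
    of a higher level. *)
Lemma limit_window s x : settled s x -> calm x ->
  window (limit b) n x = window (layer b k s) n x.
Proof.
move=> [[t0 ft0] sx] cx; apply: eq_from_tnth => t; rewrite !tnth_mktuple.
have tn : (0 + t < n)%N by rewrite add0n.
rewrite (limit_layer b0 b_incr s (cx _ tn)) layer_succ; last exact: cx.
congr (layer b k _ _); rewrite -sx (state_first ft0).
have nt0 : (n <= t0)%N by rewrite leqNgt; apply/negP => /cx; have [_ ->] := ft0.
have ft : first_high b k.+1 (drop_rows (0 + t) x) (t0 - (0 + t)).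
  have [lt ht] := ft0; split=> [r rt|]; rewrite drop_rowsD; first by apply: lt; lia.
  by rewrite subnK//; lia.
by rewrite (state_first ft) drop_rowsD subnK//; lia.
Qed.

Definition calm_prob (s : bool) (w : n.-tuple bool) : R :=
  pr mu ((settled s `&` calm) `&` [set x | window (layer b k s) n x = w]).

Definition stormy_prob (s : bool) (w : n.-tuple bool) : R :=
  pr mu (~` calm `&` [set x | window (layer b k s) n x = w]).

Lemma measurable_layer_set s : measurable [set x | layer b k s x].
Proof. exact: (measurable_layer b fair_mu). Qed.

Lemma calm_prob_le s w : calm_prob s w <= window_prob mu (limit b) w.
Proof.
have mS := measurable_settled; have mC := measurable_calm.
have mL := measurable_layer_set s.
apply: le_pr.
- by apply: measurableI; [exact: measurableI|exact: measurable_window].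
- by apply: measurable_window; exact: (measurable_limit b fair_mu).
- by move=> x [[sx cx] wx] /=; rewrite (limit_window sx cx).
Qed.

Lemma calm_prob_ge s w :
  window_prob mu (layer b k s) w / 2 - stormy_prob s w <= calm_prob s w.
Proof.
have mS := measurable_settled; have mK := measurable_calm.
have mL := measurable_layer_set s.
rewrite lerBlDr -(pr_settled_window s).
have mW : measurable [set x | window (layer b k s) n x = w] by exact: measurable_window.
have mC : measurable (~` calm) by exact: measurableC.
apply: le_trans (prU_le mu _ _).
- apply: le_pr; first exact: measurableI.
    by apply: measurableU; apply: measurableI => //; exact: measurableI.
  move=> x [sx wx]; have [cx|cx] := pselect (calm x); first by left.
  by right.
- by apply: measurableI => //; exact: measurableI.
- exact: measurableI.
Qed.

Lemma sum_window_prob (g : seqs bool -> bool) :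
  measurable [set x | g x] -> \sum_(w : n.-tuple bool) window_prob mu g w = 1.
Proof.
move=> mg; rewrite -(pr_setT mu) (pr_partition mu measurableT (f := window g n)).
  by apply: eq_bigr => w _; rewrite setTI.
by move=> w; exact: measurable_window.
Qed.

Lemma sum_stormy_prob s : \sum_w stormy_prob s w <= n%:R * 2^-1 ^+ b k.+1.
Proof.
have mC : measurable (~` calm) by exact: measurableC measurable_calm.
have mL := measurable_layer_set s.
rewrite /stormy_prob -(pr_partition mu mC (f := window (layer b k s) n)); last first.
  by move=> w; exact: measurable_window.
pose H t := drop_rows t @^-1` [set x | high b k.+1 x].
have mH t : measurable (H t).
  by apply: measurable_preimage_drop_rows; exact: measurable_high.
have hp t : pr mu (H t) <= 2^-1 ^+ b k.+1.
  by rewrite (fair_drop_rows fair_mu) ?(pr_high b fair_mu)//; exact: measurable_high.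
apply: le_trans (pr_exists_lt_le n mH hp); apply: le_pr => //.
  rewrite (_ : [set x | _] = \bigcup_(t < n) H t); last by apply/seteqP; split.
  by apply: bigcup_measurable => t _; exact: mH.
move=> x nc; apply: contrapT => nh; apply: nc => t tn; apply/negP => ht.
by apply: nh; exists t.
Qed.

(** With probability about 1/4 the first sample is in state 1 and the second in
    state 0 throughout, and then the answer is that for two different processes. *)
Lemma mean_answer_limit_ge (D : discrimination_procedure) :
  mean_answer D (@window_prob R mu (layer b k true) n)
                (@window_prob R mu (layer b k false) n) / 4
    - 3 / 2 * (n%:R * 2^-1 ^+ b k.+1) <=
  mean_answer D (@window_prob R mu (limit b) n) (@window_prob R mu (limit b) n).
Proof.
set u := @window_prob R mu (layer b k true) n.
set d := @window_prob R mu (layer b k false) n.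
have p0 s w : 0 <= calm_prob s w by exact: pr_ge0.
have st0 s w : 0 <= stormy_prob s w by exact: pr_ge0.
have u0 w : 0 <= u w by exact: pr_ge0.
have d0 w : 0 <= d w by exact: pr_ge0.
apply: (@le_trans _ _ (\sum_w \sum_w' ((D n w w')%:R * (u w * d w') / 4
    - (u w / 2 * stormy_prob false w' +
       stormy_prob true w * window_prob mu (limit b) w')))).
  rewrite (eq_bigr (fun w => (\sum_w' (D n w w')%:R * (u w * d w')) / 4 -
      (u w / 2 * \sum_w' stormy_prob false w' + stormy_prob true w))); last first.
    move=> w _; rewrite sumrB -mulr_suml big_split /= -!mulr_sumr.
    rewrite sum_window_prob ?mulr1//.
    exact: (measurable_limit b fair_mu).
  rewrite sumrB -mulr_suml big_split /= -!mulr_suml.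
  rewrite sum_window_prob; last exact: measurable_layer_set.
  rewrite lerD2l lerN2; have := sum_stormy_prob true.
  by have := sum_stormy_prob false; lra.
apply: ler_sum => w _; apply: ler_sum => w' _.
have st_le : stormy_prob true w * calm_prob false w' <=
    stormy_prob true w * window_prob mu (limit b) w'.
  by rewrite ler_wpM2l// calm_prob_le.
have h1 : (u w / 2 - stormy_prob true w) * calm_prob false w' <=
    calm_prob true w * calm_prob false w'.
  by rewrite ler_wpM2r// calm_prob_ge.
have h2 : u w / 2 * (d w' / 2 - stormy_prob false w') <= u w / 2 * calm_prob false w'.
  by rewrite ler_wpM2l ?divr_ge0// calm_prob_ge.
have h3 : calm_prob true w * calm_prob false w' <=
    window_prob mu (limit b) w * window_prob mu (limit b) w'.
  by rewrite ler_pM// calm_prob_le.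
have h4 : 0 <= u w / 2 * stormy_prob false w' by rewrite mulr_ge0// divr_ge0.
have h5 : 0 <= stormy_prob true w * window_prob mu (limit b) w'.
  by rewrite mulr_ge0// pr_ge0.
case: (D n w w') => /=; last by rewrite !mul0r; lra.
rewrite !mul1r; move: h1 h2; rewrite mulrBl mulrBr.
rewrite (_ : u w / 2 * (d w' / 2) = u w * d w' / 4); last by field.
by lra.
Qed.

End mixture.

(** * The diagonal choice of heights *)

Lemma layer_ext (b b' : nat -> nat) k s :
  (forall i, (i <= k)%N -> b i = b' i) -> layer b k s = layer b' k s.
Proof.
move=> bb'; apply/funext => x.
have hE i : (i <= k)%N -> high b i =1 high b' i.
  by move=> ik y; rewrite /high bb'.
have sE j : (j < k)%N -> state b j x = state b' j x.
  move=> jk; rewrite /state; congr (`[< _ >]); apply/propext.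
  by split=> -[t [[lt ht] dt]]; exists t; split => //; split => [r /lt|];
    rewrite ?hE// -?hE// hE.
have : (k <= k)%N by []; move: {1 3 4}k s => j s.
elim: j s => //= j IH s jk; rewrite hE// sE//; case: ifP => // _.
by apply: IH; exact: ltnW.
Qed.

Section diagonal.
Variable gap : (nat -> nat) -> nat -> nat.

(** [build k] is final up to the index [k] only. It is continued with slope 1, so
    that it is a strictly increasing sequence to which [gap], the choice of the
    next height, can be applied. *)
Fixpoint build (k : nat) : nat -> nat :=
  if k is k'.+1 then
    fun i => if (i <= k')%N then build k' i
             else (build k' k' + gap (build k') k' + (i - k'))%N
  else id.

Definition heights (k : nat) : nat := build k k.

Lemma build0 k : build k 0 = 0%N.
Proof. by elim: k. Qed.

Lemma build_incr k i : (build k i < build k i.+1)%N.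
Proof.
elim: k i => //= k IH i; case: (ltngtP i k) => [ik|ik|->]; [exact: IH|by lia|by lia].
Qed.

Lemma build_heights k i : (i <= k)%N -> build k i = heights i.
Proof.
elim: k => [|k IH]; first by rewrite leqn0 => /eqP ->.
rewrite leq_eqVlt => /orP[/eqP -> //|ik] /=; rewrite -ltnS ik.
by apply: IH.
Qed.

Lemma heights0 : heights 0 = 0%N.
Proof. by []. Qed.

Lemma heights_incr k : (heights k < heights k.+1)%N.
Proof. by rewrite -(@build_heights k.+1 k)//; exact: build_incr. Qed.

Lemma heights_gap k : (gap (build k) k < heights k.+1)%N.
Proof. by rewrite /heights /= ltnn; lia. Qed.

End diagonal.

Section impossibility.
Context (R : realType) (mu : process R bool) (fair_mu : fair mu).

Lemma cvg_mean_answer (D : discrimination_procedure) (g h : seqs bool -> bool)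
    (P Q : process R bool) (l : R) :
  is_law mu 0 (fun=> g) P -> is_law mu 0 (fun=> h) Q ->
  expected_answer D P Q @ \oo --> l%:E ->
  forall e : R, 0 < e -> exists N, forall n, (N <= n)%N ->
    `|l - mean_answer D (@window_prob R mu g n) (@window_prob R mu h n)| < e.
Proof.
move=> PE QE /fine_cvgP[_ /cvgrPdist_lt c] e e0.
have [N _ Nn] := c e e0; exists N => n leNn.
have /= := Nn n leNn; rewrite expected_answerE /=.
rewrite /mean_answer; under eq_bigr do under eq_bigr do
  rewrite (pr_law_window _ PE) (pr_law_window _ QE).
by [].
Qed.

Section consistent.
Variable D : discrimination_procedure.
Hypothesis consistent : asymptotically_consistent R D.

(** Their laws differ: [layer b k true] and [layer b k false] agree except on rows
    of height at least [k], where the first one is 1 and the second one is 0. *)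
Lemma layers_distinguished (b : nat -> nat) k :
  b 0%N = 0%N -> (forall i, (b i < b i.+1)%N) ->
  exists n, (k <= n)%N /\
    2^-1 <= mean_answer D (@window_prob R mu (layer b k true) n)
                          (@window_prob R mu (layer b k false) n).
Proof.
move=> b0 bi.
have ml s : measurable [set x | layer b k s x] := measurable_layer b fair_mu k s.
have mll s : measurable_letters (fun=> layer b k s).
  by move=> _ c; exact: measurable_bool_eq.
have law s := law_exists mu finite_bool open_bool 0 (mll s).
have [P PE] := law true; have [Q QE] := law false.
have BP s P' : is_law mu 0 (fun=> layer b k s) P' -> B_process P'.
  move=> P'E; apply: (B_process_of_layers b0 bi fair_mu (ml s) P'E) => e e0.
  exists k, s; rewrite (_ : mkset _ = set0) ?pr_set0//.
  by apply/seteqP; split => // x [].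
have neq : ~ same_process P Q.
  move=> /(_ [set x | x 0%N = true]); have m0 := measurable_bool_coord 0 true.
  move=> /(_ m0); rewrite !prE// PE// QE// !big_ord1 => -[].
  have pE s : itinerary 0 (fun=> layer b k s) 0 @^-1` [set x | x 0%N = true] =
      [set x | layer b k s x].
    by apply/seteqP; split => x; rewrite /itinerary /= drop_rows0.
  rewrite !pE invr1 !mul1r => e.
  have mh := @measurable_high b k.
  have : pr mu [set x | layer b k true x] =
      pr mu [set x | high b k x] + pr mu [set x | layer b k false x].
    rewrite -prU//.
      congr (pr mu _); apply/seteqP; split => x /=.
        have [hx|hx] := boolP (high b k x); first by left.
        by rewrite -(limit_layer b0 bi true hx) (limit_layer b0 bi false hx); right.
      case=> [hx|]; first by rewrite layer_high.
      have [hx|hx] := boolP (high b k x); first by rewrite layer_high.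
      by rewrite -(limit_layer b0 bi false hx) (limit_layer b0 bi true hx).
    by apply/seteqP; split => // x [/= hx]; rewrite layer_high.
  rewrite e (pr_high b fair_mu).
  have : 0 < 2^-1 ^+ b k :> R by rewrite exprn_gt0 ?invr_gt0.
  by lra.
have [_ /(_ neq) cv] := consistent (BP _ _ PE) (BP _ _ QE).
have h2 : 0 < 2^-1 :> R by rewrite invr_gt0.
have [N NP] := cvg_mean_answer PE QE cv h2.
exists (maxn k N); split; first exact: leq_maxl.
have := NP _ (leq_maxr k N); rewrite ltr_distl => /andP[_].
by set a := mean_answer _ _ _; lra.
Qed.

(** At the time [n] attached to level [K], the expected answer on two samples of
    the limit is at least 1/2 * 1/4 - 3/2 * 1/16 = 1/32. *)
Lemma no_consistent_procedure : False.
Proof.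
have /choice[N NP] : forall bk : (nat -> nat) * nat, exists n,
    bk.1 0%N = 0%N -> (forall i, (bk.1 i < bk.1 i.+1)%N) ->
    (bk.2 <= n)%N /\ 2^-1 <= mean_answer D
      (@window_prob R mu (layer bk.1 bk.2 true) n)
      (@window_prob R mu (layer bk.1 bk.2 false) n).
  move=> [b k] /=; have [[b0 bi]|nb] :=
    pselect (b 0%N = 0%N /\ (forall i, (b i < b i.+1)%N)).
    by have [n nP] := layers_distinguished k b0 bi; exists n.
  by exists 0%N => b0 bi; exfalso; apply: nb.
(* A height above n + 4 gives n * 2^-(n + 4) <= 1/16. *)
pose gap b k := (N (b, k) + 4)%N.
pose b := heights gap.
have b0 : b 0%N = 0%N by exact: heights0.
have bi k : (b k < b k.+1)%N by exact: heights_incr.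
have ml : measurable [set x | limit b x] by exact: (measurable_limit b fair_mu).
have mll : measurable_letters (fun=> limit b).
  by move=> _ c; exact: measurable_bool_eq.
have [P PE] := law_exists mu finite_bool open_bool 0 mll.
have BP : B_process P.
  apply: (B_process_of_layers b0 bi fair_mu ml PE) => e e0.
  have h1 : `|2^-1| < 1 :> R by rewrite ger0_norm ?invf_lt1// ltr1n.
  have /cvgrPdist_lt/(_ _ e0)[k _ /(_ k (leqnn k))] := cvg_expr h1.
  rewrite /= sub0r normrN ger0_norm ?exprn_ge0// => ke; exists k, true.
  apply: le_lt_trans ke; apply: (@le_trans _ _ (2^-1 ^+ b k)); last first.
    by apply: ler_wiXn2l; rewrite ?invf_le1 ?ler1n//; exact: b_ge.
  rewrite -(pr_high b fair_mu); apply: le_pr.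
  - by apply: measurable_neq => //; exact: (measurable_layer b fair_mu).
  - exact: measurable_high.
  - move=> x /= neq; apply: contrapT => /negP hx; apply: neq.
    exact: limit_layer.
have [/(_ (fun _ _ => erefl)) cv _] := consistent BP BP.
have e0 : 0 < 1 / 32 :> R by rewrite divr_gt0.
have [K KP] := cvg_mean_answer PE PE cv e0.
have [Kn half] := NP (build gap K, K) (build0 gap K) (build_incr gap K).
set n := N (build gap K, K) in Kn half.
have lE s : layer (build gap K) K s = layer b K s.
  by apply: layer_ext => i; exact: build_heights.
rewrite /= !lE in half.
have := mean_answer_limit_ge b0 bi fair_mu K n D.
have := KP n Kn; rewrite sub0r normrN ltr_norml => /andP[_].
have n16 : n%:R * 2^-1 ^+ b K.+1 <= 1 / 16 :> R.
  have bn : (n + 4 <= b K.+1)%N by exact/ltnW/heights_gap.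
  apply: (@le_trans _ _ (n%:R * 2^-1 ^+ (n + 4))).
    by rewrite ler_wpM2l// ler_wiXn2l// invf_le1// ler1n.
  rewrite exprD mulrA (_ : 2^-1 ^+ 4 = 1 / 16 :> R); last by field.
  rewrite ler_piMl// exprVn ler_pdivrMr ?exprn_gt0// mul1r -natrX ler_nat.
  by rewrite ltnW// ltn_expl.
move: half; set u := mean_answer _ _ _; set v := mean_answer _ _ _.
by move: n16; set w := _ * _; lra.
Qed.

End consistent.
End impossibility.

Theorem theorem3p2 (R : realType) :
  ~ (exists D : discrimination_procedure, asymptotically_consistent R D).
Proof.
move=> [D consistent]; have [mu fair_mu] := fair_exists R.
exact: no_consistent_procedure fair_mu D consistent.
Qed.
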